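(* For every nonnegative integer $n$ and every integer $k\geq 2$, \begin{align*} 4\overline{b}_5\left(5^{k}(n+3)-3\right) &\equiv 5\overline{b}_5(n) - \overline{b}_5(5n+12) \pmod{5^k},\\ \overline{b}_5\left(5^k(20n+18)-3\right) &\equiv 0 \pmod{\tfrac{5^{k}-1}{4}},\\ \overline{b}_5\left(5^k(20n+22)-3\right) &\equiv 0 \pmod{\tfrac{5^{k}-1}{4}}. \end{align*}
   Context: For $j\ge1$ let $f_j:=\prod_{k\ge 1}(1-q^{jk})$ (for $|q|<1$, or as a formal power series). Let $\psi(-q):=\sum_{n=0}^{\infty}(-q)^{n(n+1)/2}=f_1f_4/f_2$, so that $\psi(-q^5)=f_5f_{20}/f_{10}$. The integers $\overline{b}_5(n)$ are defined by $$\sum_{n=0}^\infty \overline{b}_5(n)q^n=\frac{\psi^5(-q^5)}{\psi(-q)}=1+q+q^2+2q^3+3q^4-q^5+2q^7-2q^9+6q^{10}+\cdots .$$ Note that $(5^k-1)/4$ is an integer for every $k\ge 1$. *)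

(* Defs.v *)
From mathcomp Require Import all_boot all_order all_algebra.

Set Implicit Arguments.
Unset Strict Implicit.
Unset Printing Implicit Defensive.

Import GRing.Theory.
Local Open Scope ring_scope.

(* A formal power series over int is represented by its coefficient sequence:
   [a] stands for [\sum_n a n q^n]. *)
Definition fps := nat -> int.

Definition fps_one : fps := fun n => (n == 0%N)%:R.

Definition fps_mul (a b : fps) : fps :=
  fun n => \sum_(i < n.+1) a i * b (n - i)%N.

Definition fps_exp (a : fps) (m : nat) : fps := iter m (fps_mul a) fps_one.

(* The substitution a(q) |-> a(q^d), meaningful for [0 < d]. *)
Definition fps_dilate (d : nat) (a : fps) : fps :=
  fun n => if (d %| n)%N then a (n %/ d)%N else 0.

(* [fps_inv_seq a n] lists the coefficients 0, ..., n of 1/a, obtained by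
   solving a * (1/a) = 1 degree by degree; meaningful when [a 0] is a unit of
   int (see [fps_mulV]). *)
Fixpoint fps_inv_seq (a : fps) (n : nat) : seq int :=
  if n is m.+1 then
    let s := fps_inv_seq a m in
    rcons s (- (a 0%N)^-1 * \sum_(i < m.+1) a i.+1 * s`_(m - i))
  else [:: (a 0%N)^-1].

Definition fps_inv (a : fps) : fps := fun n => (fps_inv_seq a n)`_n.

Definition fps_div (a b : fps) : fps := fps_mul a (fps_inv b).

(* psi(-q) = \sum_m (-q)^(m(m+1)/2), where m(m+1)/2 = 'C(m.+1, 2). The
   coefficient of q^n collects the m with m(m+1)/2 = n; all of them satisfy
   m <= n, so that bounding m by n loses nothing. *)
Definition psi_neg : fps :=
  fun n => \sum_(m < n.+1 | 'C(m.+1, 2) == n) (-1) ^+ n.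

(* The integers defined by \sum_n b5bar n q^n = psi(-q^5)^5 / psi(-q). *)
Definition b5bar : fps := fps_div (fps_exp (fps_dilate 5 psi_neg) 5) psi_neg.

Lemma size_fps_inv_seq a n : size (fps_inv_seq a n) = n.+1.
Proof. by elim: n => //= n IHn; rewrite size_rcons IHn. Qed.

Lemma nth_fps_inv_seq a n i : (i <= n)%N -> (fps_inv_seq a n)`_i = fps_inv a i.
Proof.
elim: n => [|n IHn]; first by case: i.
rewrite leq_eqVlt => /predU1P[-> //|lt_in].
by rewrite /= nth_rcons size_fps_inv_seq lt_in IHn.
Qed.

Lemma fps_mulV a : a 0%N \is a GRing.unit -> fps_mul a (fps_inv a) =1 fps_one.
Proof.
move=> ua [|n]; first by rewrite /fps_mul big_ord1 /fps_inv /= mulrV.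
rewrite /fps_mul big_ord_recl /= {1}/fps_inv /= subn0 nth_rcons.
rewrite size_fps_inv_seq ltnn eqxx mulrA mulrN mulrV // mulN1r.
apply/eqP; rewrite addrC subr_eq0; apply/eqP/eq_bigr => i _.
by rewrite subSS nth_fps_inv_seq ?leq_subr.
Qed.

Lemma psi_neg0 : psi_neg 0%N = 1.
Proof. by rewrite /psi_neg big_mkcond big_ord1. Qed.

Lemma dvdn4_exp5_sub1 k : (4 %| 5 ^ k - 1)%N.
Proof. by rewrite -eqn_mod_dvd ?expn_gt0 // -modnXm exp1n. Qed.

(* Main.v *)
(** Write p = psi(q), r = psi(q^5), f_m = \prod_k (1 - q^(m k)), and replace q by
-q, so that the series studied is X = q^3 r^5 / p; let Y = q p^3 r and
Z = q^2 p r^3. Two theta identities carry everything: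
  p^2 - q r^2 = f_2 f_5^3 / (f_1 f_10)                              (R1)
  phi(q^5) psi(q^2) - q phi(q) psi(q^10) = f_1 f_5                  (R2)
proved by rotating the lattices of the forms x^2 + y^2 and x^2 + 5 y^2.
(R1) gives X = Z - H(q^2) and Y - Z = H + H(q^2), with H = q f_5^5 / f_1. Let U
be the operator a_N |-> a_(5N). The 5-dissection of p gives U Z = Y and
U Y = 6 Y - 5 Z, so U multiplies Y - Z by 5; since the index is halved in
H(q^2), U also multiplies H by 5. Hence U^2 X = 6 U X - 5 X, and
4 U^k X = 5 X - U X + 5^k (U X - X).
For the other two congruences it suffices that the coefficients of X vanish at
N = 2M with M odd and N = 2, 3 modulo 5. At such N the 5-dissection gives
y_N = 3 z_N, and (R2) gives y_(2M) - z_(2M) = 2 (y_M - z_M) = 2 h_M, whence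
z_N = h_M. *)
Require Import Defs.
From HB Require Import structures.
From mathcomp Require Import all_boot all_order all_algebra.
From mathcomp Require Import zify ring.
From mathcomp Require Import boolp classical_sets.
From mathcomp Require Import cardinality fsbigop.

Set Implicit Arguments.
Unset Strict Implicit.
Unset Printing Implicit Defensive.

Import Order.TTheory GRing.Theory Num.Theory.
Local Open Scope ring_scope.

(** * The ring of formal power series *)

(** A type of its own, so that multiplication is the Cauchy product [fps_mul] and not a pointwise
    product of functions. *)
Record pseries := PSeries { pcoef :> nat -> int }.

HB.instance Definition _ := gen_eqMixin pseries.
HB.instance Definition _ := gen_choiceMixin pseries.

Lemma pseriesP (a b : pseries) : (forall n, a n = b n) -> a = b.
Proof. by case: a b => [a] [b] /= /funext ->. Qed.

Definition ps0 := PSeries (fun=> 0).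
Definition ps1 := PSeries fps_one.
Definition psadd (a b : pseries) := PSeries (fun n => a n + b n).
Definition psopp (a : pseries) := PSeries (fun n => - a n).
Definition psmul (a b : pseries) := PSeries (fps_mul a b).

Fact psaddA : associative psadd.
Proof. by move=> a b c; apply: pseriesP => n /=; rewrite addrA. Qed.
Fact psaddC : commutative psadd.
Proof. by move=> a b; apply: pseriesP => n /=; rewrite addrC. Qed.
Fact psadd0 : left_id ps0 psadd.
Proof. by move=> a; apply: pseriesP => n /=; rewrite add0r. Qed.
Fact psaddN : left_inverse ps0 psopp psadd.
Proof. by move=> a; apply: pseriesP => n /=; rewrite addNr. Qed.

HB.instance Definition _ :=
  GRing.isZmodule.Build pseries psaddA psaddC psadd0 psaddN.

Definition pstrunc (N : nat) (a : fps) : {poly int} := \poly_(i < N) a i.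

(** Each coefficient depends on finitely many others, so commutativity and associativity of the
    product are inherited from [{poly int}]. *)
Lemma fps_mul_trunc N (a b : fps) n : (n < N)%N ->
  fps_mul a b n = (pstrunc N a * pstrunc N b)`_n.
Proof.
move=> ltnN; rewrite coefM; apply: eq_bigr => i _; rewrite !coef_poly.
have := ltn_ord i; rewrite ltnS => lein.
by rewrite (leq_ltn_trans lein) // (leq_ltn_trans (leq_subr _ _)).
Qed.

Lemma fps_mulC (a b : fps) : fps_mul a b =1 fps_mul b a.
Proof. by move=> n; rewrite !(@fps_mul_trunc n.+1) // mulrC. Qed.

Fact psmulC : commutative psmul.
Proof. by move=> a b; apply: pseriesP => n /=; rewrite fps_mulC. Qed.

Fact psmulA : associative psmul.
Proof.
have E (x y z : fps) n : fps_mul x (fps_mul y z) n =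
  (pstrunc n.+1 x * (pstrunc n.+1 y * pstrunc n.+1 z))`_n.
  rewrite coefM; apply: eq_bigr => i _.
  rewrite coef_poly ltn_ord (@fps_mul_trunc n.+1) //.
  by rewrite ltnS leq_subr.
move=> a b c; apply: pseriesP => n /=.
by rewrite E fps_mulC E [in RHS]mulrC mulrA.
Qed.

Fact psmul1 : left_id ps1 psmul.
Proof.
move=> a; apply: pseriesP => n /=; rewrite /fps_mul big_ord_recl /= subn0 mul1r.
by rewrite big1 ?addr0 // => i _; rewrite mul0r.
Qed.

Fact psmulDl : left_distributive psmul psadd.
Proof.
move=> a b c; apply: pseriesP => n /=; rewrite /fps_mul -big_split /=.
by apply: eq_bigr => i _; rewrite mulrDl.
Qed.

Fact ps1_neq0 : ps1 != ps0.
Proof. by apply/eqP => /(congr1 (fun a : pseries => a 0%N)). Qed.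

HB.instance Definition _ := GRing.Zmodule_isComNzRing.Build pseries
  psmulA psmulC psmul1 psmulDl ps1_neq0.

Lemma psaddE (a b : pseries) n : (a + b) n = a n + b n. Proof. by []. Qed.
Lemma psoppE (a : pseries) n : (- a) n = - a n. Proof. by []. Qed.
Lemma psmulE (a b : pseries) n : (a * b) n = \sum_(i < n.+1) a i * b (n - i)%N.
Proof. by []. Qed.
Lemma ps1E n : (1 : pseries) n = (n == 0%N)%:R. Proof. by []. Qed.

Lemma pssumE I (s : seq I) (P : pred I) (F : I -> pseries) n :
  (\sum_(i <- s | P i) F i) n = \sum_(i <- s | P i) F i n.
Proof. by elim/big_rec2: _ => // i x y _ <-. Qed.

Lemma psmulnE (a : pseries) k n : (a *+ k) n = a n *+ k.
Proof. by elim: k => // k IHk; rewrite !mulrS psaddE IHk. Qed.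

Lemma psmul_natE k (a : pseries) n : (k%:R * a) n = k%:R * a n.
Proof. by rewrite mulr_natl psmulnE mulr_natl. Qed.

Lemma psmul_coef0 (a b : pseries) : (a * b) 0%N = a 0%N * b 0%N.
Proof. by rewrite psmulE big_ord1. Qed.

Lemma psexp_coef0 (a : pseries) n : (a ^+ n) 0%N = a 0%N ^+ n.
Proof. by elim: n => // n IHn; rewrite !exprS psmul_coef0 IHn. Qed.

Definition psinv (a : pseries) := PSeries (fps_inv a).

Lemma psmulV (a : pseries) : a 0%N = 1 -> a * psinv a = 1.
Proof. by move=> a0; apply: pseriesP => n; apply: fps_mulV; rewrite a0 unitr1. Qed.

(** This is how quotients of infinite products are compared below: denominators with constant term 1
    are cleared first. *)
Lemma psmulI (a b c : pseries) : a 0%N = 1 -> a * b = a * c -> b = c.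
Proof.
move=> a0 abc; rewrite -[b]mul1r -[c]mul1r -(psmulV a0) ![a * _]mulrC.
by rewrite -!mulrA abc.
Qed.

Definition q := PSeries (fun n => (n == 1%N)%:R).

Lemma qXE k n : (q ^+ k) n = (n == k)%:R.
Proof.
elim: k n => [|k IHk] n; first by rewrite ps1E.
rewrite exprS psmulE; case: n => [|n]; first by rewrite big_ord1 mul0r.
rewrite big_ord_recl mul0r add0r big_ord_recl /= mul1r IHk subSS subn0.
by rewrite big1 ?addr0 // => i _; rewrite mul0r.
Qed.

Lemma qXmulE k (a : pseries) n :
  (q ^+ k * a) n = if (k <= n)%N then a (n - k)%N else 0.
Proof.
rewrite psmulE; case: leqP => [lekn|ltnk].
  rewrite (bigD1 (inord k)) //= inordK // qXE eqxx mul1r big1 ?addr0 // => i.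
  by rewrite -val_eqE /= inordK // qXE => /negPf ->; rewrite mul0r.
by apply: big1 => i _; rewrite qXE ltn_eqF ?mul0r // (leq_ltn_trans _ ltnk) // -ltnS.
Qed.

Lemma qmulE (a : pseries) n : (q * a) n = if n is n'.+1 then a n' else 0.
Proof. by rewrite -[q]expr1 qXmulE; case: n => // n; rewrite subn1. Qed.

Lemma qXmulI k (a b : pseries) : q ^+ k * a = q ^+ k * b -> a = b.
Proof.
move=> ab; apply: pseriesP => n; move/(congr1 (fun x : pseries => x (k + n)%N)): ab.
by rewrite !qXmulE leq_addr addKn.
Qed.

(** * Substitutions q -> q^d and q -> -q, and sections along residue classes *)

Definition dilate d (a : pseries) := PSeries (fps_dilate d a).

Lemma dilateE d (a : pseries) n :
  dilate d a n = if (d %| n)%N then a (n %/ d)%N else 0.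
Proof. by []. Qed.

Lemma dilate_mulE d (a : pseries) n : (0 < d)%N -> dilate d a (d * n)%N = a n.
Proof. by move=> d0; rewrite dilateE dvdn_mulr // mulKn. Qed.

Fact dilate_additive d : nmod_morphism (dilate d).
Proof.
split=> [|a b]; apply: pseriesP => n /=; rewrite /fps_dilate; case: ifP => //.
Qed.

HB.instance Definition _ d :=
  GRing.isNmodMorphism.Build pseries pseries (dilate d) (dilate_additive d).

Lemma sum_dvdn (R : nmodType) d n r (F : nat -> R) : (r < d)%N ->
    (forall i, ~~ (d %| i)%N -> F i = 0) ->
  \sum_(i < (d * n + r).+1) F i = \sum_(i < n.+1) F (d * i)%N.
Proof.
move=> ltrd F0; have d0 : (0 < d)%N by lia.
transitivity (\sum_(i < (d * n).+1) F i).
  elim: r ltrd => [|r IHr] ltrd; first by rewrite addn0.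
  rewrite addnS big_ord_recr /= IHr 1?ltnW // F0 ?addr0 // -addnS.
  by rewrite dvdn_addr ?dvdn_mulr // gtnNdvd.
elim: n => [|n IHn]; first by rewrite muln0 !big_ord1 muln0.
rewrite [RHS]big_ord_recr /= -IHn.
have -> : (d * n.+1).+1 = ((d * n).+1 + d)%N by lia.
rewrite big_split_ord /=; congr (_ + _).
case: d d0 F0 {IHn ltrd} => // d _ F0; rewrite big_ord_recr /= big1 ?add0r.
  by congr F; lia.
move=> i _; apply: F0; have := ltn_ord i; move: (nat_of_ord i) => k ltkd.
by rewrite addSnnS dvdn_addr ?dvdn_mulr // gtnNdvd.
Qed.

Fact dilate_multiplicative d : monoid_morphism (dilate d).
Proof.
split=> [|a b].
  apply: pseriesP => n; rewrite dilateE !ps1E; case: ifPn => [/dvdnP[k ->]|].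
    case: d => [|d]; first by rewrite muln0 div0n.
    by rewrite mulnK // muln_eq0 orbF.
  by case: n => [|n]; rewrite ?dvdn0.
(* For [d = 0] only the constant coefficient survives, since [0 %| n] forces [n = 0]; this map is
   multiplicative as well. *)
case: d => [|d].
  apply: pseriesP => n; rewrite dilateE dvd0n [RHS]psmulE.
  case: eqP => [->|n0]; first by rewrite div0n psmul_coef0 big_ord1 !dilateE !dvdn0 !div0n.
  apply/esym/big1 => i _; rewrite !dilateE !dvd0n.
  have [->|] := eqVneq (i : nat) 0%N; last by rewrite mul0r.
  by rewrite subn0; move/eqP/negPf: n0 => ->; rewrite mulr0.
apply: pseriesP => n; rewrite dilateE.
case: ifPn => [/dvdnP[k ->]|Ndn]; last first.
  apply/esym/big1 => i _; rewrite !dilateE.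
  case: ifPn => [di|]; last by rewrite mul0r.
  rewrite ifN ?mulr0 //; apply: contra Ndn => dni.
  by rewrite -(subnK (_ : i <= n)%N) ?dvdn_add // -ltnS.
rewrite mulnK // mulnC [RHS]psmulE -[(d.+1 * k)%N]addn0.
rewrite (@sum_dvdn _ d.+1 k 0 (fun i => dilate d.+1 a i * dilate d.+1 b (d.+1 * k + 0 - i)%N)) //.
  by apply: eq_bigr => i _; rewrite addn0 -mulnBr !dilate_mulE.
by move=> i Ndi; rewrite dilateE (negPf Ndi) mul0r.
Qed.

HB.instance Definition _ d :=
  GRing.isMonoidMorphism.Build pseries pseries (dilate d) (dilate_multiplicative d).

Lemma dilateD d : {morph dilate d : a b / a + b}. Proof. exact: rmorphD. Qed.
Lemma dilateB d : {morph dilate d : a b / a - b}. Proof. exact: rmorphB. Qed.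
Lemma dilateM d : {morph dilate d : a b / a * b}. Proof. exact: rmorphM. Qed.
Lemma dilate1 d : dilate d 1 = 1. Proof. exact: rmorph1. Qed.
Lemma dilateX d k : {morph dilate d : a / a ^+ k}. Proof. exact: rmorphXn. Qed.

Lemma dilate_q d : (0 < d)%N -> dilate d q = q ^+ d.
Proof.
move=> d0; apply: pseriesP => n; rewrite qXE dilateE /=.
case: ifPn => [/dvdnP[k ->]|]; first by rewrite mulnK // -{2}[d]mul1n eqn_pmul2r.
by case: eqVneq => [->|//]; rewrite dvdnn.
Qed.

Lemma dilate_comp c d (a : pseries) : (0 < c)%N -> (0 < d)%N ->
  dilate c (dilate d a) = dilate (c * d) a.
Proof.
move=> c0 d0; apply: pseriesP => n; rewrite !dilateE.
case: ifPn => [/dvdnP[k ->]|Nc].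
  by rewrite mulnK // [(k * c)%N]mulnC dvdn_pmul2l // divnMl.
by rewrite ifN //; apply: contra Nc; apply: dvdn_trans; rewrite dvdn_mulr.
Qed.

Lemma dilate_coef0 d (a : pseries) : dilate d a 0%N = a 0%N.
Proof. by rewrite dilateE dvdn0 div0n. Qed.

Lemma dilate_inv d (a : pseries) : (a 0%N = 1) ->
  dilate d (psinv a) = psinv (dilate d a).
Proof.
move=> a0; apply: (@psmulI (dilate d a)); first by rewrite dilate_coef0.
by rewrite -rmorphM !psmulV ?rmorph1 // dilate_coef0.
Qed.

Definition qneg (a : pseries) := PSeries (fun n => (-1) ^+ n * a n).

Fact qneg_additive : nmod_morphism qneg.
Proof.
split=> [|a b]; apply: pseriesP => n /=; first by rewrite mulr0.
by rewrite mulrDr.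
Qed.

HB.instance Definition _ :=
  GRing.isNmodMorphism.Build pseries pseries qneg qneg_additive.

Fact qneg_multiplicative : monoid_morphism qneg.
Proof.
split=> [|a b]; apply: pseriesP => n.
  by case: n => [|n] /=; rewrite ?mulr0 // mul1r.
rewrite [RHS]psmulE [LHS]/= [fps_mul a b n](psmulE a b) big_distrr /=.
apply: eq_bigr => i _; rewrite mulrACA -exprD subnKC //.
by rewrite -ltnS.
Qed.

HB.instance Definition _ :=
  GRing.isMonoidMorphism.Build pseries pseries qneg qneg_multiplicative.

Lemma qnegK : involutive qneg.
Proof. by move=> a; apply: pseriesP => n /=; rewrite mulrA -expr2 sqrr_sign mul1r. Qed.

Lemma qneg_q : qneg q = - q.
Proof. by apply: pseriesP => [[|[|n]]] /=; rewrite ?mulr0 ?oppr0. Qed.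

Lemma qneg_dilate_odd d (a : pseries) : odd d ->
  qneg (dilate d a) = dilate d (qneg a).
Proof.
move=> od; have d0 : (0 < d)%N by case: d od.
apply: pseriesP => n /=; rewrite /fps_dilate; case: ifPn => [/dvdnP[k ->]|_].
  by rewrite mulnK //= -signr_odd oddM od andbT signr_odd.
by rewrite mulr0.
Qed.

Lemma qneg_dilate_even d (a : pseries) : ~~ odd d ->
  qneg (dilate d a) = dilate d a.
Proof.
move=> ed; apply: pseriesP => n /=; rewrite /fps_dilate; case: ifPn => [/dvdnP[k ->]|_].
  by rewrite -signr_odd oddM (negPf ed) andbF mul1r.
by rewrite mulr0.
Qed.

Definition section d i (a : pseries) := PSeries (fun n => a (d * n + i)%N).

Lemma sectionE d i (a : pseries) n : section d i a n = a (d * n + i)%N.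
Proof. by []. Qed.

Lemma sectionD d i : {morph section d i : a b / a + b}.
Proof. by move=> a b; apply: pseriesP. Qed.

(** Sections modulo [d] are linear over the series in q^d, because multiplying by such a series
    preserves the residue class of the index. *)
Lemma section_dilateM d i (a b : pseries) : (i < d)%N ->
  section d i (dilate d a * b) = a * section d i b.
Proof.
move=> ltid; have d0 : (0 < d)%N by lia.
apply: pseriesP => n; rewrite sectionE !psmulE.
rewrite (@sum_dvdn _ d n i (fun j => dilate d a j * b (d * n + i - j)%N)) //.
  apply: eq_bigr => j _; rewrite dilate_mulE // sectionE.
  by congr (_ * b _); have := ltn_ord j; nia.
by move=> j Ndj; rewrite dilateE (negPf Ndj) mul0r.
Qed.

Lemma section_qX d i k (a : pseries) : (i < d)%N ->
  section d i (q ^+ k * dilate d a) =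
  if (k %% d == i)%N then q ^+ (k %/ d) * a else 0.
Proof.
move=> ltid; rewrite mulrC section_dilateM //; case: ifP => [/eqP ki|ki].
  rewrite mulrC; congr (_ * _); apply: pseriesP => n; rewrite sectionE !qXE.
  by rewrite {1}(divn_eq k d) ki eqn_add2r mulnC eqn_pmul2r //; lia.
rewrite (_ : section _ _ _ = 0) ?mulr0 //; apply: pseriesP => n.
rewrite sectionE qXE; case: eqP => // nk; move: ki.
by rewrite -nk mulnC modnMDl modn_small ?eqxx.
Qed.

(** * Sums over lattices *)

Local Open Scope classical_set_scope.

(* \sum_t w(t) q^e(t). An infinite fiber of [e] yields the coefficient 0;
   [summable] excludes this. *)
Definition gsum (T : choiceType) (e w : T -> int) :=
  PSeries (fun n => \sum_(t \in [set t | e t = n%:Z]) w t).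

Definition summable (T : choiceType) (e : T -> int) :=
  (forall t, 0 <= e t) /\ forall n : nat, finite_set [set t | e t = n%:Z].

Lemma gsumE (T : choiceType) (e w : T -> int) n :
  gsum e w n = \sum_(t \in [set t | e t = n%:Z]) w t.
Proof. by []. Qed.

Lemma eq_gsum (T : choiceType) (e e' w w' : T -> int) :
  e =1 e' -> w =1 w' -> gsum e w = gsum e' w'.
Proof. by move=> /funext -> /funext ->. Qed.

Lemma gsum_reindex (S T : choiceType) (h : S -> T) (g : T -> S) (e w : T -> int) :
  cancel h g -> cancel g h -> gsum e w = gsum (e \o h) (w \o h).
Proof.
move=> hK gK; apply: pseriesP => n; rewrite !gsumE.
apply: reindex_fsbig; split=> [s //|s s' _ _ /(can_inj hK) //|t /= et].
by exists (g t) => //=; rewrite gK.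
Qed.

Lemma summable_reindex (S T : choiceType) (h : S -> T) (g : T -> S) (e : T -> int) :
  cancel h g -> cancel g h -> summable e -> summable (e \o h).
Proof.
move=> hK gK [e0 fe]; split=> [s|n]; first exact: e0.
have -> : [set s | (e \o h) s = n%:Z] = g @` [set t | e t = n%:Z].
  apply/seteqP; split=> [s /= es|_ [t /= et <-]] /=; last by rewrite gK.
  by exists (h s) => //=; rewrite hK.
exact: finite_image.
Qed.

(** A comparison test: a fiber of [e'] embeds by [h] into finitely many fibers of [e]. *)
Lemma summable_le (S T : choiceType) (h : S -> T) (k : nat) (e : T -> int)
    (e' : S -> int) : injective h -> (forall s, 0 <= e' s) ->
  (forall s, e (h s) <= e' s + k%:Z) -> summable e -> summable e'.
Proof.
move=> hI e0' he [e0 fe]; split=> // n.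
have sub : [set s | e' s = n%:Z] `<=`
    h @^-1` (\bigcup_(i in `I_(n + k).+1) [set t | e t = i%:Z]).
  move=> s /= es; have := he s; have := e0 (h s); rewrite es => e0s esn.
  by exists `|e (h s)|%N => /=; rewrite ?gez0_abs //; lia.
apply: sub_finite_set sub _; apply: finite_preimage; first by move=> ? ? _ _ /hI.
by apply: bigcup_finite => // i _.
Qed.

Lemma summable_scale (T : choiceType) (e : T -> int) (k : nat) : (0 < k)%N ->
  summable e -> summable (fun t => k%:Z * e t).
Proof.
move=> k0 se; have [e0 _] := se.
by apply: (@summable_le _ _ id 0 e) => // t; have := e0 t; nia.
Qed.

Lemma summable_prod (S T : choiceType) (e : S -> int) (e' : T -> int) :
  summable e -> summable e' -> summable (fun x : S * T => e x.1 + e' x.2).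
Proof.
move=> [e0 fe] [e0' fe']; split=> [x|n]; first by rewrite addr_ge0.
have sub : [set x : S * T | e x.1 + e' x.2 = n%:Z] `<=`
    (\bigcup_(i in `I_n.+1) [set t | e t = i%:Z]) `*`
    (\bigcup_(i in `I_n.+1) [set t | e' t = i%:Z]).
  move=> [s t] /= est; have := e0 s; have := e0' t => es et; split=> /=.
    by exists `|e s|%N => /=; rewrite ?gez0_abs //; lia.
  by exists `|e' t|%N => /=; rewrite ?gez0_abs //; lia.
by apply: sub_finite_set sub _; apply: finite_setX; apply: bigcup_finite.
Qed.

Lemma gsum_shift (T : choiceType) (e w : T -> int) (k : nat) : summable e ->
  q ^+ k * gsum e w = gsum (fun t => k%:Z + e t) w.
Proof.
move=> [e0 _]; apply: pseriesP => n; rewrite qXmulE !gsumE.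
case: leqP => kn; first by apply: eq_fsbigl; apply/seteqP; split=> t /=; lia.
apply/esym; apply: fsbig1 => t /= et; have := e0 t; lia.
Qed.

Lemma gsum_dilate (T : choiceType) (e w : T -> int) (d : nat) : (0 < d)%N ->
  dilate d (gsum e w) = gsum (fun t => d%:Z * e t) w.
Proof.
move=> d0; apply: pseriesP => n; rewrite dilateE !gsumE.
case: ifPn => [/dvdnP[k ->]|Ndn].
  by rewrite mulnK //; apply: eq_fsbigl; apply/seteqP; split=> t /=; nia.
apply/esym; apply: fsbig1 => t /= et; exfalso; move/negP: Ndn; apply.
by apply/dvdnP; exists `|e t|%N; nia.
Qed.

Lemma gsum_mul (S T : choiceType) (e w : S -> int) (e' w' : T -> int) :
  summable e -> summable e' ->
  gsum e w * gsum e' w' =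
  gsum (fun x : S * T => e x.1 + e' x.2) (fun x => w x.1 * w' x.2).
Proof.
move=> [e0 fe] [e0' fe']; apply: pseriesP => n; rewrite psmulE gsumE.
pose A i := [set x : S * T | e x.1 = i%:Z /\ e x.1 + e' x.2 = n%:Z].
have AE (i : nat) : (i <= n)%N ->
    A i = [set t | e t = i%:Z] `*` [set t | e' t = (n - i)%N%:Z].
  by move=> lein; apply/seteqP; split=> -[s t] /=; rewrite /A /=; lia.
transitivity (\sum_(i < n.+1) \sum_(x \in A i) (w x.1 * w' x.2)).
  apply: eq_bigr => i _; rewrite !gsumE AE -1?ltnS //.
  rewrite -(@pair_fsbig _ _ _ _ _ _ _ (fun s t => w s * w' t)) //.
  rewrite mulr_fsuml; apply: eq_fsbigr => s _.
  by rewrite mulr_fsumr.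
have fA (i : nat) : (i <= n)%N -> finite_set (A i).
  by move=> lein; rewrite AE //; apply: finite_setX.
(* The layers [A i] are glued one at a time: the first [m] of them form the part of the fiber where
   [e x.1 < m]. *)
suff H m : (m <= n.+1)%N -> \sum_(i < m) \sum_(x \in A i) (w x.1 * w' x.2) =
    \sum_(x \in [set x | e x.1 < m%:Z /\ e x.1 + e' x.2 = n%:Z]) (w x.1 * w' x.2).
  rewrite H //; apply: eq_fsbigl; apply/seteqP; split=> -[s t] /=.
    by case.
  by have := e0' t; lia.
elim: m => [|m IHm] ltmn.
  by rewrite big_ord0; apply/esym/fsbig1 => -[s t] /=; have := e0 s; lia.
rewrite big_ord_recr /= IHm 1?ltnW // -fsbigU0.
- by apply: eq_fsbigl; apply/seteqP; split=> -[s t] /=; rewrite /A /=; lia.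
- have sub : [set x : S * T | e x.1 < m%:Z /\ e x.1 + e' x.2 = n%:Z] `<=` 
     \bigcup_(i in `I_n.+1) A i.
    move=> [s t] /= est; have := e0 s => es.
    by exists `|e s|%N => /=; rewrite /A /=; lia.
  apply: sub_finite_set sub _; apply: bigcup_finite => // i /=; exact: fA.
- exact: fA.
- by move=> -[s t] /=; rewrite /A /=; lia.
Qed.

(** Here [c] gives the class of a point, [g] its coordinate within the class, and [h i] parametrizes
    class [i]. *)
Lemma gsum_split (d : nat) (S T : choiceType) (h : nat -> S -> T) (c : T -> nat)
    (g : T -> S) (e w : T -> int) :
  (forall i s, (i < d)%N -> c (h i s) = i /\ g (h i s) = s) ->
  (forall t, (c t < d)%N /\ h (c t) (g t) = t) -> summable e ->
  gsum e w = \sum_(i < d) gsum (e \o h i) (w \o h i).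
Proof.
move=> hK gK [e0 fe]; apply: pseriesP => n; rewrite pssumE.
pose A i := [set t | c t = i /\ e t = n%:Z].
have fA i : finite_set (A i).
  by apply: sub_finite_set (fe n) => t [].
transitivity (\sum_(i < d) \sum_(t \in A i) w t); last first.
  apply: eq_bigr => i _; rewrite gsumE; apply: reindex_fsbig; split.
  - by move=> s /= es; split => //; have [] := hK i s (ltn_ord i).
  - move=> s s' _ _ hs; have [_ <-] := hK i s (ltn_ord i); rewrite hs.
    by have [] := hK i s' (ltn_ord i).
  - move=> t [ct et] /=; have [_] := gK t; rewrite ct => ht.
    by exists (g t) => //=; rewrite ht.
have H m : (m <= d)%N -> \sum_(i < m) \sum_(t \in A i) w t =
    \sum_(t \in [set t | (c t < m)%N /\ e t = n%:Z]) w t.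
  elim: m => [|m IHm] ltmd.
    by rewrite big_ord0; apply/esym/fsbig1 => t /=; lia.
  rewrite big_ord_recr /= IHm 1?ltnW // -fsbigU0 //.
  - by apply: eq_fsbigl; apply/seteqP; split=> t /=; rewrite /A /=; lia.
  - by apply: sub_finite_set (fe n) => t [].
  - by move=> t /=; rewrite /A /=; lia.
rewrite H // gsumE; apply: eq_fsbigl; apply/seteqP; split=> t /=.
  by move=> et; have [] := gK t.
by case.
Qed.

Lemma gsum_int_split (d : nat) (e w : int -> int) : (0 < d)%N -> summable e ->
  gsum e w = \sum_(0 <= i < d) gsum (fun t => e (d%:Z * t + i%:Z))
                               (fun t => w (d%:Z * t + i%:Z)).
Proof.
move=> d0 se; rewrite big_mkord.
have -> := @gsum_split d _ _ (fun i t => d%:Z * t + i%:Z)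
  (fun t => `|(t %% d%:Z)%Z|%N) (fun t => (t %/ d%:Z)%Z) e w _ _ se; first by [].
  move=> i t ltid; rewrite [d%:Z * t]mulrC modzMDl modz_small ?divzMDl; try lia.
  by rewrite divz_small; lia.
move=> t; have := divz_eq t d; have := @modz_ge0 t d; have := @ltz_pmod t d.
by lia.
Qed.

Lemma gsum_int2_split (d : nat) (T : choiceType) (e w : int * T -> int) :
    (0 < d)%N -> summable e ->
  gsum e w = \sum_(0 <= i < d) gsum (fun x => e (d%:Z * x.1 + i%:Z, x.2))
                               (fun x => w (d%:Z * x.1 + i%:Z, x.2)).
Proof.
move=> d0 se; rewrite big_mkord.
have -> := @gsum_split d _ _ (fun i x => (d%:Z * x.1 + i%:Z, x.2))
  (fun x => `|(x.1 %% d%:Z)%Z|%N) (fun x => ((x.1 %/ d%:Z)%Z, x.2)) e w _ _ se; first by [].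
  move=> i [t y] ltid /=; rewrite [d%:Z * t]mulrC modzMDl modz_small ?divzMDl; try lia.
  by rewrite divz_small ?addr0 ?absz_nat; [split | lia].
move=> [t y] /=; have := divz_eq t d; have := @modz_ge0 t d; have := @ltz_pmod t d.
move=> h1 h2 h3; split; first by lia.
congr pair; lia.
Qed.

(** * Infinite products and the triple product identity *)

Definition eqps N (a b : pseries) := forall n, (n < N)%N -> a n = b n.

Lemma eqps_sym N (a b : pseries) : eqps N a b -> eqps N b a.
Proof. by move=> ab n /ab. Qed.

Lemma eqps_trans N (a b c : pseries) : eqps N a b -> eqps N b c -> eqps N a c.
Proof. by move=> ab bc n ltnN; rewrite ab ?bc. Qed.

Lemma eqps_mul N (a b c d : pseries) : eqps N a b -> eqps N c d -> eqps N (a * c) (b * d).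
Proof.
move=> ab cd n ltnN; rewrite !psmulE; apply: eq_bigr => i _.
have := ltn_ord i; rewrite ltnS => lein.
by rewrite ab ?cd // (leq_ltn_trans _ ltnN) // leq_subr.
Qed.

Lemma eqpsP (a b : pseries) : (forall N, eqps N a b) -> a = b.
Proof. by move=> ab; apply: pseriesP => n; apply: (ab n.+1). Qed.

Lemma eqps_cancel N (a b c : pseries) : a 0%N = 1 -> eqps N (a * b) (a * c) -> eqps N b c.
Proof.
move=> a0 abc; have := eqps_mul (fun n _ => erefl : psinv a n = _) abc.
by rewrite !mulrA [psinv a * a]mulrC psmulV // !mul1r.
Qed.

Lemma psmulzE (z : int) (a : pseries) n : (z%:~R * a) n = z * a n.
Proof.
rewrite mulrzl; case: z => k; first by rewrite -pmulrn psmulnE -mulr_natl natz.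
by rewrite NegzE mulrNz psoppE -pmulrn psmulnE mulNr -mulr_natl natz.
Qed.

(** Under [near1] the factors of index above [n] are 1 modulo q^(n+1), so this finite product
    already has the final coefficient of q^n. *)
Definition pinf (u : nat -> pseries) :=
  PSeries (fun n => (\prod_(k < n.+1) u k) n).

Definition near1 (u : nat -> pseries) := forall k, eqps k.+1 (u k) 1.

Lemma pinf_eqps u N n : near1 u -> (N <= n)%N ->
  eqps N (pinf u) (\prod_(k < n) u k).
Proof.
move=> u1 leNn d ltdN; have ltdn := leq_trans ltdN leNn.
rewrite [LHS]/= -(subnK ltdn) addnC.
elim: (n - d.+1)%N => [|j IHj]; first by rewrite addn0.
rewrite addnS [in RHS]big_ord_recr /= IHj -[in LHS](mulr1 (\prod_(k < _) _)).
by apply: (@eqps_mul d.+1) => // k ltkd; apply/esym/u1; lia.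
Qed.

Lemma pinf_coef0 u : near1 u -> pinf u 0%N = 1.
Proof. by move=> u1; rewrite /= big_ord1 u1. Qed.

Definition qfactor (eps : int) (i m k : nat) : pseries :=
  1 + eps%:~R * q ^+ (i + m * k).

(** In Pochhammer notation, (-eps q^i; q^m)_infinity. *)
Definition qprod eps i m := pinf (qfactor eps i m).

Lemma qfactor_near1 eps i m : (0 < i)%N -> (0 < m)%N -> near1 (qfactor eps i m).
Proof.
move=> i0 m0 k n ltnk; rewrite psaddE psmulzE qXE ltn_eqF ?mulr0 ?addr0 //.
nia.
Qed.

Lemma qprod_eqps eps i m N n : (0 < i)%N -> (0 < m)%N -> (N <= n)%N ->
  eqps N (qprod eps i m) (\prod_(k < n) qfactor eps i m k).
Proof. by move=> i0 m0; apply: pinf_eqps; apply: qfactor_near1. Qed.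

Lemma qprod_coef0 eps i m : (0 < i)%N -> (0 < m)%N -> qprod eps i m 0%N = 1.
Proof. by move=> i0 m0; apply/pinf_coef0/qfactor_near1. Qed.

Lemma prod_residues (R : comNzRingType) d n (F : nat -> R) :
  \prod_(k < d * n) F k = \prod_(c < d) \prod_(k < n) F (c + d * k)%N.
Proof.
rewrite exchange_big /=; elim: n => [|n IHn]; first by rewrite muln0 !big_ord0.
rewrite mulnS addnC big_split_ord big_ord_recr /= IHn; congr (_ * _).
by apply: eq_bigr => c _; rewrite addnC.
Qed.

Lemma qprod_residues d eps i m : (0 < d)%N -> (0 < i)%N -> (0 < m)%N ->
  qprod eps i m = \prod_(c < d) qprod eps (i + m * c) (m * d).
Proof.
move=> d0 i0 m0; apply: eqpsP => N.
apply: eqps_trans (qprod_eqps eps i0 m0 (_ : N <= d * N)%N) _; first by nia.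
rewrite prod_residues; apply: (big_ind2 (eqps N)) => //.
  by move=> a b c e; apply: eqps_mul.
move=> c _; apply: eqps_sym.
have -> : \prod_(k < N) qfactor eps i m (c + d * k)%N =
    \prod_(k < N) qfactor eps (i + m * c) (m * d) k.
  by apply: eq_bigr => k _; rewrite /qfactor mulnDr mulnA addnA.
by apply: qprod_eqps => //; nia.
Qed.

Lemma qprodM_opp i m : (0 < i)%N -> (0 < m)%N ->
  qprod 1 i m * qprod (-1) i m = qprod (-1) (2 * i) (2 * m).
Proof.
move=> i0 m0; apply: eqpsP => N.
apply: eqps_trans (eqps_mul (qprod_eqps _ i0 m0 (leqnn N)) (qprod_eqps _ i0 m0 (leqnn N))) _.
rewrite -big_split /=; apply: eqps_sym.
have -> : \prod_(k < N) (qfactor 1 i m k * qfactor (-1) i m k) =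
    \prod_(k < N) qfactor (-1) (2 * i) (2 * m) k.
  apply: eq_bigr => k _; rewrite /qfactor -mulnA -mulnDr [(2 * _)%N]mulnC exprM.
  by rewrite !mulrNz !mulr1z; ring.
by apply: qprod_eqps => //; nia.
Qed.

Lemma dilate_qprod d eps i m : (0 < d)%N -> (0 < i)%N -> (0 < m)%N ->
  dilate d (qprod eps i m) = qprod eps (d * i) (d * m).
Proof.
move=> d0 i0 m0; apply: eqpsP => N.
have di0 : (0 < d * i)%N by nia.
have dm0 : (0 < d * m)%N by nia.
apply: eqps_trans (eqps_sym (qprod_eqps _ di0 dm0 (leqnn N))).
have -> : \prod_(k < N) qfactor eps (d * i) (d * m) k =
    dilate d (\prod_(k < N) qfactor eps i m k).
  rewrite rmorph_prod; apply: eq_bigr => k _.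
  by rewrite rmorphD rmorphM rmorph1 rmorph_int rmorphXn /= dilate_q // -exprM mulnDr mulnA.
move=> n ltnN; rewrite !dilateE; case: ifP => // _.
by apply: qprod_eqps (leqnn N) _ _ => //; apply: leq_ltn_trans ltnN; apply: leq_div.
Qed.

(** * Gaussian binomial coefficients *)

Section QBinomial.
Variables (R : comNzRingType) (Q : R).

(** The Gaussian binomial coefficient [a + b choose a], indexed by the two parts so that Pascal's
    rule involves neither subtraction nor division. *)
Fixpoint qbinom a : nat -> R :=
  if a is a'.+1 then
    fix qb b := if b is b'.+1 then qb b' + Q ^+ b * qbinom a' b else 1
  else fun=> 1.

Lemma qbinomSS a b :
  qbinom a.+1 b.+1 = qbinom a.+1 b + Q ^+ b.+1 * qbinom a b.+1.
Proof. by []. Qed.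

Lemma qbinom0 b : qbinom 0 b = 1. Proof. by []. Qed.
Lemma qbinomn0 a : qbinom a 0 = 1. Proof. by case: a. Qed.
Arguments qbinom : simpl never.

Definition qpoch n := \prod_(k < n) (1 - Q ^+ k.+1).

Lemma qpochS n : qpoch n.+1 = qpoch n * (1 - Q ^+ n.+1).
Proof. by rewrite /qpoch big_ord_recr. Qed.

(** The two terms of Pascal's rule combine through 1 - Q^(a+b+2) = (1 - Q^(b+1)) + Q^(b+1) (1 -
    Q^(a+1)). *)
Lemma qbinom_qpoch a b : qbinom a b * (qpoch a * qpoch b) = qpoch (a + b).
Proof.
elim: a b => [|a IHa] b; first by rewrite qbinom0 {1}/qpoch big_ord0 !mul1r.
elim: b => [|b IHb].
  by rewrite qbinomn0 {2}/qpoch big_ord0 mul1r mulr1 addn0.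
rewrite qbinomSS mulrDl [in X in X + _]qpochS.
have := IHa b.+1; rewrite addnS -addSn => IHa'.
rewrite addnS [RHS]qpochS.
transitivity ((1 - Q ^+ b.+1) * (qbinom a.+1 b * (qpoch a.+1 * qpoch b)) +
  Q ^+ b.+1 * (1 - Q ^+ a.+1) * (qbinom a b.+1 * (qpoch a * qpoch b.+1))).
  by rewrite !qpochS; ring.
rewrite IHb IHa' -[(a.+1 + b).+1]addnS exprD; ring.
Qed.

Lemma qbinomial_theorem N (A B : R) :
  \prod_(k < N) (A + B * Q ^+ k) =
  \sum_(a < N.+1) qbinom a (N - a) * Q ^+ 'C(a, 2) * B ^+ a * A ^+ (N - a).
Proof.
elim: N => [|N IHN].
  by rewrite big_ord0 big_ord1 qbinom0 !expr0 !mulr1.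
rewrite big_ord_recr /= IHN mulrDr !mulr_suml /=.
(* The extreme terms each come from only one summand of the last factor A + B Q^N; every inner term
   comes from both, by Pascal's rule. *)
rewrite big_ord_recl big_ord_recr /= [RHS]big_ord_recl big_ord_recr /=.
rewrite !subn0 subnn [bump 0 N]add1n subnn !qbinom0 !qbinomn0 bin0n !expr0 !mul1r -exprSr.
rewrite -!addrA; congr (_ + _); rewrite !addrA -big_split /= binS bin1 exprD.
congr (_ + _); last by rewrite exprS; ring.
apply: eq_bigr => -[a /= ltaN] _; rewrite /bump leq0n add1n.
have [b ->] : exists b, N = (a.+1 + b)%N by exists (N - a.+1)%N; lia.
have -> : (a.+1 + b - a.+1 = b)%N by lia.
have -> : (a.+1 + b - a = b.+1)%N by lia.
have -> : ((a.+1 + b).+1 - a.+1 = b.+1)%N by lia.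
rewrite qbinomSS binS bin1 addSn -addnS !exprD !exprS; ring.
Qed.

End QBinomial.

(** * Theta series and their finite forms *)

Definition tri (j : int) : int := ((j * (j - 1)) %/ 2)%Z.

Lemma tri_double j : 2 * tri j = j * (j - 1).
Proof.
rewrite /tri mulrC divzK //.
have [k [->|->]] : exists k : int, j = k * 2 \/ j = k * 2 + 1.
- by exists (j %/ 2)%Z; lia.
- by rewrite mulrAC dvdz_mull.
- by rewrite addrK mulrA dvdz_mull.
Qed.

Lemma tri_nat (n : nat) : tri n%:Z = 'C(n, 2)%:Z.
Proof.
have := tri_double n; elim: n => [|n IHn]; first by rewrite bin0n; lia.
by have := tri_double n; rewrite binS bin1 => /[dup] /IHn; lia.
Qed.

Definition theta_exp (m i : nat) (j : int) : int := m%:Z * tri j + i%:Z * j.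

(** For eps = 1 or -1 this is Ramanujan's f(eps q^i, eps q^(m-i)); as such an eps is its own
    inverse, [absz] gives the right sign for negative [j]. *)
Definition theta (eps : int) (m i : nat) :=
  gsum (theta_exp m i) (fun j => eps ^+ `|j|%N).

(** The exponent is i j (j + 1) / 2 + (m - i) j (j - 1) / 2 with both coefficients at least 1, hence
    at least j^2. *)
Lemma theta_exp_ge m i j : (0 < i < m)%N -> `|j| <= theta_exp m i j.
Proof.
move=> /andP[i0 im]; rewrite /theta_exp; have := tri_double j.
have [k ->] : exists k, m = (i + 1 + k)%N by exists (m - i - 1)%N; lia.
have [l ->] : exists l, i = l.+1 by exists i.-1; lia.
case: (intP j) => [|n|n] /=; nia.
Qed.

Lemma summable_abs : summable (fun j : int => `|j|).
Proof.
split=> [j //|n].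
have sub : [set j : int | `|j| = n%:Z] `<=` [set n%:Z; - n%:Z].
  by move=> j /= jn; lia.
exact: sub_finite_set sub (finite_set2 _ _).
Qed.

Lemma summable_theta m i : (0 < i < m)%N -> summable (theta_exp m i).
Proof.
move=> him; apply: (@summable_le _ _ id 0 (fun j : int => `|j|)) => // [j|j|].
- by rewrite (le_trans _ (theta_exp_ge _ him)).
- by rewrite addr0 theta_exp_ge.
- exact: summable_abs.
Qed.

(* The q-binomial theorem with A = q^(m n), B = eps q^i and 2 n factors, divided
   by the monomial that the first n factors have in common: this homogeneous form
   avoids negative exponents. *)
Lemma finite_triple_product (eps : int) m i n : eps * eps = 1 -> (0 < i < m)%N ->
  (\prod_(k < n) qfactor eps i m k) * (\prod_(k < n) qfactor eps (m - i) m k) =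
  \sum_(a < (2 * n).+1) (eps ^+ `|a%:Z - n%:Z|%N)%:~R *
     q ^+ `|theta_exp m i (a%:Z - n%:Z)|%N * qbinom (q ^+ m) a (2 * n - a).
Proof.
move=> eps1 him.
have epsR : (eps%:~R : pseries) * eps%:~R = 1 by rewrite -intrM eps1.
have eps2 a b : (eps ^+ (a + b.*2))%:~R = (eps ^+ a)%:~R :> pseries.
  by rewrite exprD -muln2 mulnC exprM expr2 eps1 expr1n mulr1.
(* [K] is the exponent taken out of the product: i n + m C(n, 2) from the first [n] factors, and m n
   from each of the last [n]. *)
pose K := (i * n + m * 'C(n, 2) + m * n * n)%N.
pose E : pseries := (eps ^+ n)%:~R.
have EE : E * E = 1 by rewrite -intrM -exprMn eps1 expr1n.
have expE a : (a <= 2 * n)%N ->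
    (m * 'C(a, 2) + i * a + m * n * (2 * n - a) =
     K + `|theta_exp m i (a%:Z - n%:Z)|)%N.
  move=> lea; have := le_trans (normr_ge0 _) (theta_exp_ge (a%:Z - n%:Z) him).
  rewrite /theta_exp /K => th0; have := tri_double (a%:Z - n%:Z).
  have := tri_double a; have := tri_double n; rewrite !tri_nat => h1 h2 h3.
  apply: (can_inj absz_nat); apply: eqP.
  nia.
have := qbinomial_theorem (q ^+ m) (2 * n) (q ^+ (m * n)) (eps%:~R * q ^+ i).
have -> : \prod_(k < 2 * n) (q ^+ (m * n) + eps%:~R * q ^+ i * (q ^+ m) ^+ k) =
    E * q ^+ K * ((\prod_(k < n) qfactor eps i m k) *
                  (\prod_(k < n) qfactor eps (m - i) m k)).
  rewrite mul2n -addnn big_split_ord /= mulrC.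
  have -> : \prod_(k < n) (q ^+ (m * n) + eps%:~R * q ^+ i * (q ^+ m) ^+ (n + k)) =
      q ^+ (m * n * n) * \prod_(k < n) qfactor eps i m k.
    have -> : q ^+ (m * n * n) = \prod_(k < n) q ^+ (m * n).
      by rewrite prodr_const card_ord exprM.
    rewrite -big_split /=; apply: eq_bigr => k _.
    by rewrite /qfactor -exprM mulnDr !exprD; ring.
  have -> : \prod_(k < n) (q ^+ (m * n) + eps%:~R * q ^+ i * (q ^+ m) ^+ k) =
      E * q ^+ (i * n + m * 'C(n, 2)) * \prod_(k < n) qfactor eps (m - i) m k.
    have -> : E * q ^+ (i * n + m * 'C(n, 2)) =
        \prod_(k < n) (eps%:~R * q ^+ (i + m * k)).
      rewrite /E; elim: (n) => [|N IHN]; first by rewrite big_ord0 bin0n !muln0 mulr1.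
      rewrite big_ord_recr /= -IHN binS bin1 exprSr intrM mulnS !mulnDr !exprD; ring.
    (* Taking eps q^(i + m k) out of factor [k] leaves, as eps^2 = 1, the factor of index n - 1 - k
       of the second product; hence the reversal. *)
    rewrite [\prod_(k < n) qfactor _ _ _ _](reindex_inj rev_ord_inj) -big_split /=.
    apply: eq_bigr => -[k /= ltkn] _; rewrite /qfactor mulrDr mulr1 addrC -exprM exprD.
    have -> : (m * n = i + m * k + (m - i + m * (n - k.+1)))%N.
      by have [j ->] : exists j, n = (k.+1 + j)%N; [exists (n - k.+1)%N|]; nia.
    rewrite !exprD; move: (eps%:~R) epsR => e ee; rewrite -[in LHS](mul1r (q ^+ (m - i))) -ee; ring.
  by rewrite /K !exprD; ring.
move=> qbin; apply: (@qXmulI K).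
have EI x y : E * x = E * y -> x = y.
  by move=> /(congr1 ( *%R E)); rewrite !mulrA EE !mul1r.
apply: EI; rewrite [LHS]mulrA [RHS]mulrA {}qbin mulr_sumr.
apply: eq_bigr => -[a /= ltan] _.
have lea : (a <= 2 * n)%N by lia.
transitivity ((eps ^+ a)%:~R * (q ^+ (m * 'C(a, 2)) * q ^+ (i * a) * q ^+ (m * n * (2 * n - a))) *
   qbinom (q ^+ m) a (2 * n - a)).
  rewrite exprMn -!exprM rmorphXn /=; ring.
(* An even power of eps is added to turn [a] into n + |a - n|; truncated subtraction makes it
   trivial when n <= a. *)
rewrite -(eps2 a (n - a)%N).
have -> : (a + (n - a).*2 = n + `|a%:Z - n%:Z|)%N by lia.
by rewrite -!exprD (expE a lea) exprD exprD intrM -/E; ring.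
Qed.

Lemma qpoch_eqps m N n : (0 < m)%N -> (N <= n)%N ->
  eqps N (qpoch (q ^+ m) n) (qprod (-1) m m).
Proof.
move=> m0 leNn; apply: eqps_sym.
have -> : qpoch (q ^+ m) n = \prod_(k < n) qfactor (-1) m m k.
  by apply: eq_bigr => k _; rewrite /qfactor -exprM mulnS mulrNz mulr1z mulN1r.
exact: qprod_eqps.
Qed.

(** When both parts are large, all three Pochhammer products in [qbinom_qpoch] agree with the
    infinite one modulo q^N. *)
Lemma qbinom_eqps m N a b : (0 < m)%N -> (N <= a)%N -> (N <= b)%N ->
  eqps N (qbinom (q ^+ m) a b * qprod (-1) m m) 1.
Proof.
move=> m0 lea leb; set F := qprod _ _ _.
apply: (@eqps_cancel _ F); first exact: qprod_coef0.
have leab : (N <= a + b)%N by lia.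
rewrite mulr1; apply: eqps_trans (qpoch_eqps m0 leab); rewrite -qbinom_qpoch.
rewrite mulrCA; apply: eqps_mul => //.
by apply: eqps_mul; apply: eqps_sym; apply: qpoch_eqps.
Qed.

Theorem jacobi_triple_product eps m i : eps * eps = 1 -> (0 < i < m)%N ->
  theta eps m i = qprod eps i m * qprod eps (m - i) m * qprod (-1) m m.
Proof.
move=> eps1 him; have m0 : (0 < m)%N by lia.
have i0 : (0 < i)%N by lia.
have mi0 : (0 < m - i)%N by lia.
(* Terms reaching q^N have |a - n| <= N; this [n] then keeps [a] and [2 * n - a] at or above [N.+1],
   as [qbinom_eqps] requires. *)
apply: pseriesP => N; set n := (2 * N.+1)%N.
have leNn : (N.+1 <= n)%N by lia.
have /(_ N (ltnSn N)) -> := eqps_mul (eqps_mul (qprod_eqps eps i0 m0 leNn)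
  (qprod_eqps eps mi0 m0 leNn)) (fun k _ => erefl (qprod (-1) m m k)).
rewrite finite_triple_product // mulr_suml pssumE.
transitivity (\sum_(a < (2 * n).+1)
   (if `|theta_exp m i (a%:Z - n%:Z)|%N == N then eps ^+ `|a%:Z - n%:Z|%N else 0)).
  pose r := [seq a%:Z - n%:Z | a : nat <- [seq a <- index_iota 0 (2 * n).+1 |
     `|theta_exp m i (a%:Z - n%:Z)|%N == N]].
  transitivity (\sum_(j <- r) eps ^+ `|j|%N); last first.
    by rewrite big_map big_filter big_mkcond big_mkord.
  rewrite gsumE [RHS]fsbig_seq; last first.
    by rewrite map_inj_uniq ?filter_uniq ?iota_uniq // => a b; lia.
  apply: eq_fsbigl; apply/seteqP; split=> j /=.
    move=> jN; have := theta_exp_ge j him; rewrite jN => leN.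
    apply/mapP; exists (absz (j + n%:Z)); last by lia.
    rewrite mem_filter mem_index_iota.
    by have -> : (absz (j + n%:Z))%:Z - n%:Z = j; [lia | rewrite jN /=; lia].
  move=> /mapP[a + ->]; rewrite mem_filter => /andP[/eqP <- _].
  by rewrite gez0_abs // (le_trans _ (theta_exp_ge _ him)).
apply: eq_bigr => a' _; move: (nat_of_ord a') (ltn_ord a') => a ltan.
rewrite -!mulrA psmulzE qXmulE.
have := theta_exp_ge (a%:Z - n%:Z) him; set t := theta_exp _ _ _ => let_t.
case: (leqP `|t|%N N) => tN; last by rewrite mulr0 gtn_eqF.
rewrite (@qbinom_eqps m N.+1 a (2 * n - a) m0); try lia.
rewrite ps1E subn_eq0 eqn_leq tN /=; case: leqP => _; rewrite ?mulr1 ?mulr0 //.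
Qed.

(** * Theta functions *)

Lemma gsum_scale (T : choiceType) (e w : T -> int) (c : int) :
  gsum e (fun t => c * w t) = c%:~R * gsum e w.
Proof. by apply: pseriesP => n; rewrite psmulzE !gsumE mulr_fsumr. Qed.

Notation tsum e := (gsum e (fun=> 1)).

Lemma tsum_mul (S T : choiceType) (e : S -> int) (e' : T -> int) :
  summable e -> summable e' ->
  tsum e * tsum e' = tsum (fun x : S * T => e x.1 + e' x.2).
Proof. exact: gsum_mul. Qed.

Definition quad (a b c x : int) : int := a * (x * x) + b * x + c.

Lemma summable_quad a b c : `|b| <= a -> 0 < a -> 0 <= c -> summable (quad a b c).
Proof.
(* The slack 1 comes from x^2 - |x| >= |x| - 1. *)
move=> ba a0 c0; apply: (@summable_le _ _ id 1 (fun j : int => `|j|)) => // [x|x|].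
- by rewrite /quad; case: (intP x) => [|n|n]; nia.
- by rewrite /quad; case: (intP x) => [|n|n]; nia.
- exact: summable_abs.
Qed.

#[local] Hint Extern 0 (summable (quad _ _ _)) =>
  solve [by apply: summable_quad] : core.

(* Every affine bijection of the integers is [x |-> s * x + t] with s = ±1. *)
Lemma tsum_affine (s t a b c a' b' c' : int) : s * s = 1 ->
  (forall x, quad a b c (s * x + t) = quad a' b' c' x) ->
  tsum (quad a b c) = tsum (quad a' b' c').
Proof.
move=> ss E; rewrite (@gsum_reindex _ _ (fun x => s * x + t) (fun x => s * (x - t))).
- by apply: eq_gsum => x //=; rewrite E.
- by move=> x; rewrite addrK mulrA ss mul1r.
- by move=> x; rewrite mulrA ss mul1r subrK.
Qed.

Lemma tsum_quadD (k : nat) a b c : summable (quad a b c) ->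
  q ^+ k * tsum (quad a b c) = tsum (quad a b (k%:Z + c)).
Proof. by move=> s; rewrite gsum_shift //; apply: eq_gsum => // x; rewrite /quad; ring. Qed.

Lemma tsum_quadS a b c : summable (quad a b c) ->
  q * tsum (quad a b c) = tsum (quad a b (1 + c)).
Proof. exact: (@tsum_quadD 1). Qed.

Lemma dilate_tsum_quad (d : nat) a b c : (0 < d)%N ->
  dilate d (tsum (quad a b c)) = tsum (quad (d%:Z * a) (d%:Z * b) (d%:Z * c)).
Proof. by move=> s; rewrite gsum_dilate //; apply: eq_gsum => // x; rewrite /quad; ring. Qed.

Lemma tsum_quad_split (d : nat) a b c : (0 < d)%N -> summable (quad a b c) ->
  tsum (quad a b c) =
  \sum_(0 <= i < d) tsum (quad (d%:Z ^+ 2 * a) (d%:Z * (2 * a * i%:Z + b)) (quad a b c i%:Z)).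
Proof.
move=> d0 s; rewrite (gsum_int_split _ d0 s); apply: eq_bigr => i _.
by apply: eq_gsum => // x; rewrite /quad; ring.
Qed.

(** In Ramanujan's notation these are f(q, q^3), f(q, q), f(q^2, q^3) and f(q, q^4). The two-sided
    form of [psi] makes it a sum over a lattice. *)
Definition psi := theta 1 4 1.
Definition phi := theta 1 2 1.
Definition psiA := theta 1 5 2.
Definition psiB := theta 1 5 1.

Lemma theta1E m i : theta 1 m i = tsum (theta_exp m i).
Proof. by apply: eq_gsum => // j; rewrite expr1n. Qed.

Lemma psiE : psi = tsum (quad 2 (-1) 0).
Proof.
rewrite /psi theta1E; apply: eq_gsum => // j.
by rewrite /theta_exp /quad; have := tri_double j; lia.
Qed.

Lemma phiE : phi = tsum (quad 1 0 0).
Proof.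
rewrite /phi theta1E; apply: eq_gsum => // j.
by rewrite /theta_exp /quad; have := tri_double j; lia.
Qed.

(** Splitting by the parity of the index removes the half-integral coefficients, so that [quad]
    applies. *)
Lemma psiAE : psiA = tsum (quad 10 (-1) 0) + tsum (quad 10 9 2).
Proof.
rewrite /psiA theta1E (@gsum_int_split 2) //; last exact: summable_theta.
rewrite /index_iota /= big_cons big_cons big_nil addr0; congr (_ + _); apply: eq_gsum => // t;
  rewrite /theta_exp /quad.
  by have := tri_double (2%:Z * t + 0%:Z); lia.
by have := tri_double (2%:Z * t + 1%:Z); lia.
Qed.

Lemma psiBE : psiB = tsum (quad 10 (-3) 0) + tsum (quad 10 7 1).
Proof.
rewrite /psiB theta1E (@gsum_int_split 2) //; last exact: summable_theta.
rewrite /index_iota /= big_cons big_cons big_nil addr0; congr (_ + _); apply: eq_gsum => // t;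
  rewrite /theta_exp /quad.
  by have := tri_double (2%:Z * t + 0%:Z); lia.
by have := tri_double (2%:Z * t + 1%:Z); lia.
Qed.

Lemma psi_5dissection :
  psi = dilate 5 psiA + q * dilate 5 psiB + q ^+ 3 * dilate 25 psi.
Proof.
rewrite psiAE psiBE !dilateD {2}psiE !dilate_tsum_quad //.
rewrite [q * (_ + _)]mulrDr !tsum_quadS // tsum_quadD //.
rewrite psiE (@tsum_quad_split 5) // /index_iota subn0 [iota 0 5]/=.
rewrite !big_cons big_nil addr0.
(* For indices congruent to 0 or 3 modulo 5 the exponent is 0 modulo 5, for 1 or 2 it is 1, and
   index class 4 gives the last term. *)
have perm (x0 x1 x2 x3 x4 : pseries) :
  x0 + (x1 + (x2 + (x3 + x4))) = x0 + x3 + (x1 + x2) + x4 by ring.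
rewrite perm; congr (_ + _ + (_ + _) + _).
- by apply/esym/(@tsum_affine (-1) (-1)) => // x; rewrite /quad; ring.
- by apply/esym/(@tsum_affine (-1) 0) => // x; rewrite /quad; ring.
- by apply/esym/(@tsum_affine 1 1) => // x; rewrite /quad; ring.
Qed.

(** This unimodular change of variables finishes the rotation in [psi_sqr_sub], where 2 (5 x + 2
    y)^2 + 2 y^2 = 10 x^2 + 10 (y + 2 x)^2. *)
Lemma tsum_shear (e : int * int -> int) (k : nat) (s t s' t' a b c a' b' c' : int) :
    s * s = 1 -> s' * s' = 1 ->
    summable (quad a b c) -> summable (quad a' b' c') ->
  (forall x y, e (x, y) = k%:Z + (quad a b c (s * x + t) +
                                  quad a' b' c' (s' * (y + 2 * x) + t'))) ->
  tsum e = q ^+ k * (tsum (quad a b c) * tsum (quad a' b' c')).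
Proof.
move=> ss ss' se se' E.
have sK z : s * (s * z) = z by rewrite mulrA ss mul1r.
have sK' z : s' * (s' * z) = z by rewrite mulrA ss' mul1r.
have sp := summable_prod se se'.
rewrite gsum_mul // gsum_shift //.
rewrite [RHS](@gsum_reindex _ _
  (fun x : int * int => (s * x.1 + t, s' * (x.2 + 2 * x.1) + t'))
  (fun x => (s * (x.1 - t), s' * (x.2 - t') - 2 * (s * (x.1 - t))))).
- by apply: eq_gsum => // -[x y] /=; rewrite E ?mulr1.
- by move=> [x y] /=; rewrite !addrK !sK !sK' addrK.
- by move=> [x y] /=; rewrite !sK subrK !subrK sK' subrK.
Qed.

(* The rotation (u, v) |-> (u - 2v, 2u + v) of the Gaussian lattice, applied to
   psi(q)^2 = \sum q^((u^2 + v^2 - 2) / 8) over u = v = 1 mod 4, splits this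
   sum according to the residue of u - 2v modulo 5. *)
Lemma psi_sqr_sub : psi ^+ 2 = psiA * psiB + q * dilate 5 psi ^+ 2.
Proof.
rewrite psiAE psiBE psiE dilate_tsum_quad // !expr2 tsum_mul //.
rewrite (@gsum_reindex _ _ (fun x : int * int => (x.1 + 2 * x.2, x.2))
  (fun x => (x.1 - 2 * x.2, x.2))); first last.
- by move=> [x y] /=; congr pair; ring.
- by move=> [x y] /=; congr pair; ring.
rewrite (@gsum_int2_split 5) //; last first.
  apply: (@summable_reindex _ _ _ (fun x => (x.1 - 2 * x.2, x.2))).
  - by move=> [x y] /=; congr pair; ring.
  - by move=> [x y] /=; congr pair; ring.
  - exact: summable_prod.
rewrite /index_iota subn0 [iota 0 5]/= !big_cons big_nil addr0.
(* Class 1 gives q psi(q^5)^2; the other four classes are the four products in the expansion of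
   [psiA * psiB]. *)
rewrite (@tsum_shear _ 0 (-1) 0 1 0 10 (-1) 0 10 (-3) 0) //; last first.
  by move=> x y; rewrite /quad /=; ring.
rewrite (@tsum_shear _ 1 (-1) 0 (-1) 0 (5%:Z * 2) (5%:Z * -1) (5%:Z * 0)
  (5%:Z * 2) (5%:Z * -1) (5%:Z * 0)) //; last first.
  by move=> x y; rewrite /quad /=; ring.
rewrite (@tsum_shear _ 0 1 0 (-1) (-1) 10 9 2 10 7 1) //; last first.
  by move=> x y; rewrite /quad /=; ring.
rewrite (@tsum_shear _ 0 (-1) (-1) (-1) (-1) 10 7 1 10 (-1) 0) //; last first.
  by move=> x y; rewrite /quad /=; ring.
rewrite (@tsum_shear _ 0 1 1 1 1 10 (-3) 0 10 9 2) //; last first.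
  by move=> x y; rewrite /quad /=; ring.
by ring.
Qed.

(** The involution x -> -1 - x exchanges even and odd [x], so each half of the sum equals
    psi(q^2). *)
Lemma tsum_pronic : tsum (quad 1 1 0) = 2%:R * dilate 2 psi.
Proof.
rewrite (@tsum_quad_split 2) // psiE dilate_tsum_quad //.
rewrite /index_iota subn0 [iota 0 2]/= !big_cons big_nil addr0 [RHS]mulr_natl [RHS]mulr2n.
congr (_ + _).
  by apply/esym/(@tsum_affine (-1) 0) => // x; rewrite /quad; ring.
by apply/esym/(@tsum_affine 1 1) => // x; rewrite /quad; ring.
Qed.

(** * Product forms of the theta functions *)

Definition euler m := qprod (-1) m m.

Lemma euler_coef0 m : (0 < m)%N -> euler m 0%N = 1.
Proof. by move=> m0; apply: qprod_coef0. Qed.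

Lemma dilate_euler d m : (0 < d)%N -> (0 < m)%N ->
  dilate d (euler m) = euler (d * m).
Proof. by move=> d0 m0; exact: dilate_qprod. Qed.

Lemma qprod2 eps i m : (0 < i)%N -> (0 < m)%N ->
  qprod eps i m = qprod eps i (2 * m) * qprod eps (i + m) (2 * m).
Proof.
move=> i0 m0; rewrite (@qprod_residues 2) // !big_ord_recl big_ord0 mulr1 /=.
by rewrite muln0 addn0 /bump /= addn0 muln1 mulnC.
Qed.

(** The classes 1, 2, 0 modulo 3 of the factors of f_1 are the three products of the triple product
    identity. *)
Lemma pentagonal : euler 1 = theta (-1) 3 1.
Proof.
rewrite jacobi_triple_product // /euler (@qprod_residues 3) //.
by rewrite !big_ord_recl big_ord0 mulr1 !mulrA.
Qed.

Lemma psi_euler : psi * euler 1 = euler 2 ^+ 2.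
Proof.
have H1 : psi = qprod 1 1 2 * euler 4.
  by rewrite /psi jacobi_triple_product // (@qprod2 1 1 2).
have H2 : euler 1 = qprod (-1) 1 2 * euler 2 by rewrite /euler (@qprod2 (-1) 1 1).
have H3 : euler 2 = qprod (-1) 2 4 * euler 4 by rewrite /euler (@qprod2 (-1) 2 2).
have H4 : qprod 1 1 2 * qprod (-1) 1 2 = qprod (-1) 2 4 by rewrite qprodM_opp.
rewrite H1 H2 expr2 [in X in _ = X * _]H3 -H4; ring.
Qed.

Lemma phi_euler : phi * (euler 1 ^+ 2 * euler 4 ^+ 2) = euler 2 ^+ 5.
Proof.
have H1 : phi = qprod 1 1 2 ^+ 2 * euler 2.
  by rewrite /phi jacobi_triple_product.
have H2 : euler 1 = qprod (-1) 1 2 * euler 2 by rewrite /euler (@qprod2 (-1) 1 1).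
have H3 : euler 2 = qprod (-1) 2 4 * euler 4 by rewrite /euler (@qprod2 (-1) 2 2).
have H4 : qprod 1 1 2 * qprod (-1) 1 2 = qprod (-1) 2 4 by rewrite qprodM_opp.
transitivity ((qprod 1 1 2 * qprod (-1) 1 2 * euler 4) ^+ 2 * euler 2 ^+ 3).
  by rewrite H1 H2; ring.
by rewrite H4 -H3 -exprD.
Qed.

Definition phi_neg := theta (-1) 2 1.

Lemma phi_neg_euler : phi_neg * euler 2 = euler 1 ^+ 2.
Proof.
have H1 : phi_neg = qprod (-1) 1 2 ^+ 2 * euler 2.
  by rewrite /phi_neg jacobi_triple_product.
have H2 : euler 1 = qprod (-1) 1 2 * euler 2 by rewrite /euler (@qprod2 (-1) 1 1).
by rewrite H1 H2; ring.
Qed.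

(** The numerators of [psiA] and [psiB] use up the four nonzero classes modulo 5 of the factors of
    (-q; q)_infinity = f_2 / f_1; the remaining class is f_10 / f_5. *)
Lemma psiAB_euler :
  psiA * psiB * (euler 1 * euler 10) = euler 2 * euler 5 ^+ 3.
Proof.
have H1 : psiA = qprod 1 2 5 * qprod 1 3 5 * euler 5.
  by rewrite /psiA jacobi_triple_product.
have H2 : psiB = qprod 1 1 5 * qprod 1 4 5 * euler 5.
  by rewrite /psiB jacobi_triple_product.
have H3 : qprod 1 1 1 = qprod 1 1 5 * qprod 1 2 5 * qprod 1 3 5 * qprod 1 4 5 * qprod 1 5 5.
  by rewrite (@qprod_residues 5) // !big_ord_recl big_ord0 mulr1 !mulrA.
have H4 : qprod 1 1 1 * euler 1 = euler 2 by rewrite /euler qprodM_opp.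
have H5 : qprod 1 5 5 * euler 5 = euler 10 by rewrite /euler qprodM_opp.
rewrite H1 H2 -H4 H3 -H5; ring.
Qed.

Lemma gsum_qneg (T : choiceType) (e w : T -> int) :
  qneg (gsum e w) = gsum e (fun t => (-1) ^+ absz (e t) * w t).
Proof.
apply: pseriesP => n; rewrite gsumE /= mulr_fsumr.
by apply: eq_fsbigr => t; rewrite inE /= => ->.
Qed.

Lemma sgr_absz (x y : int) : (exists z, x - y = 2 * z) ->
  (-1) ^+ absz x = (-1) ^+ absz y :> int.
Proof.
move=> [z xy]; rewrite -signr_odd -[RHS]signr_odd; congr (_ ^+ nat_of_bool _).
by lia.
Qed.

Lemma qneg_phi : qneg phi = phi_neg.
Proof.
rewrite phiE gsum_qneg /phi_neg; apply: eq_gsum => j.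
  by rewrite /theta_exp /quad; have := tri_double j; lia.
rewrite mulr1; apply: sgr_absz; exists (tri j).
by rewrite tri_double /quad; ring.
Qed.

(* Twice each of the two products in [phi_psi_euler] is a sum over a lattice with
   the form x^2 + 5 y^2 (the exponents are (x^2 + 5 y^2 - 1) / 4), cut into
   the classes c modulo 3 of [n + s], indexed by [s = 3 t + c - n].
   [formZ] comes from phi(q^5) psi(q^2), [formW] from q phi(q) psi(q^10). *)
Definition formZ (c : int) (x : int * int) : int :=
  5 * ((3 * x.1 + c - x.2) * (3 * x.1 + c - x.2)) + (x.2 * x.2 + x.2).
Definition formW (c : int) (x : int * int) : int :=
  1 + ((3 * x.1 + c - x.2) * (3 * x.1 + c - x.2)) + 5 * (x.2 * x.2 + x.2).

Lemma tsum_mod3 (e : int * int -> int) : summable e ->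
  tsum e = tsum (fun x => e (3 * x.1 + 0 - x.2, x.2)) +
           tsum (fun x => e (3 * x.1 + 1 - x.2, x.2)) +
           tsum (fun x => e (3 * x.1 + 2 - x.2, x.2)).
Proof.
move=> se; have hK : cancel (fun x : int * int => (x.1 - x.2, x.2)) (fun x => (x.1 + x.2, x.2)).
  by move=> [x y] /=; rewrite subrK.
have gK : cancel (fun x : int * int => (x.1 + x.2, x.2)) (fun x => (x.1 - x.2, x.2)).
  by move=> [x y] /=; rewrite addrK.
rewrite (gsum_reindex _ _ hK gK) (@gsum_int2_split 3) //; last first.
  exact: summable_reindex hK gK se.
by rewrite /index_iota subn0 [iota 0 3]/= !big_cons big_nil addr0 addrA.
Qed.

Lemma phi5_psi2 : 2%:R * (dilate 5 phi * dilate 2 psi) =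
  tsum (formZ 0) + tsum (formZ 1) + tsum (formZ 2).
Proof.
rewrite mulrCA -tsum_pronic phiE dilate_tsum_quad // tsum_mul // tsum_mod3.
  congr (_ + _ + _); apply: eq_gsum => // x; rewrite /formZ /quad /=; ring.
exact: summable_prod.
Qed.

Lemma phi_psi10 : 2%:R * (q * phi * dilate 10 psi) =
  tsum (formW 0) + tsum (formW 1) + tsum (formW 2).
Proof.
have -> : 2%:R * (q * phi * dilate 10 psi) = q * phi * dilate 5 (tsum (quad 1 1 0)).
  by rewrite tsum_pronic dilateM (dilate_comp _ (isT : 0 < 5)%N) // rmorph_nat; ring.
rewrite phiE dilate_tsum_quad // tsum_quadS // tsum_mul // tsum_mod3.
  congr (_ + _ + _); apply: eq_gsum => // x; rewrite /formW /quad /=; ring.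
exact: summable_prod.
Qed.

Lemma tsum_affine2 (a b c d u v a' b' c' d' u' v' : int) (e e' : int * int -> int) :
  (forall x y, a' * (a * x + b * y + u) + b' * (c * x + d * y + v) + u' = x) ->
  (forall x y, c' * (a * x + b * y + u) + d' * (c * x + d * y + v) + v' = y) ->
  (forall x y, a * (a' * x + b' * y + u') + b * (c' * x + d' * y + v') + u = x) ->
  (forall x y, c * (a' * x + b' * y + u') + d * (c' * x + d' * y + v') + v = y) ->
  (forall x y, e (a * x + b * y + u, c * x + d * y + v) = e' (x, y)) ->
  tsum e = tsum e'.
Proof.
move=> h1 h2 h3 h4 E.
rewrite (@gsum_reindex _ _ (fun x => (a * x.1 + b * x.2 + u, c * x.1 + d * x.2 + v))
  (fun x => (a' * x.1 + b' * x.2 + u', c' * x.1 + d' * x.2 + v'))).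
- by apply: eq_gsum => // -[x y] /=; rewrite E.
- by move=> [x y] /=; rewrite h1 h2.
- by move=> [x y] /=; rewrite h3 h4.
Qed.

(** The symmetry (s, n) -> (-s, -1 - n) sends s + n to -1 - (s + n), which exchanges the classes 0
    and 2 modulo 3. *)
Lemma formZ02 : tsum (formZ 0) = tsum (formZ 2).
Proof.
apply: (@tsum_affine2 (-1) 0 0 (-1) (-1) (-1) (-1) 0 0 (-1) (-1) (-1)) => x y;
  rewrite /formZ /=; ring.
Qed.

Lemma formW02 : tsum (formW 0) = tsum (formW 2).
Proof.
apply: (@tsum_affine2 (-1) 0 0 (-1) (-1) (-1) (-1) 0 0 (-1) (-1) (-1)) => x y;
  rewrite /formW /=; ring.
Qed.

(** Attach 2 n + 1 + 2 s sqrt(-5) to a point of [formZ] and 2 s + (2 n + 1) sqrt(-5) to one of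
    [formW]. The isometry sending alpha to (2 + sqrt(-5)) / 3 times its conjugate is integral on
    class 1 and carries the first kind to the second. *)
Lemma formWZ1 : tsum (formW 1) = tsum (formZ 1).
Proof.
apply: (@tsum_affine2 1 0 (-2) 1 0 (-1) 1 0 2 1 0 1) => x y;
  rewrite /formW /formZ /=; ring.
Qed.

(* Multiplication by 1 + sqrt(-5), of norm 6, turns the elements of the lattice
   into [x + y sqrt(-5)] with [x = 6 k - 1] and [y = 6 l - 1], and the sign
   (-1)^(k + l) of the pentagonal series tells [formZ] from [formW]. *)
Lemma euler1_euler5 : euler 1 * euler 5 = tsum (formZ 2) - tsum (formW 2).
Proof.
have -> : euler 5 = dilate 5 (euler 1) by rewrite dilate_euler.
have s3 : summable (theta_exp 3 1) by exact: summable_theta.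
have s5 : summable (fun j => 5%:Z * theta_exp 3 1 j) by exact: summable_scale.
rewrite pentagonal gsum_dilate // gsum_mul //.
(* With the difference of the two pentagonal indices as first coordinate, its parity alone decides
   the sign. *)
have hK : cancel (fun x : int * int => (x.1 + x.2, x.2)) (fun x => (x.1 - x.2, x.2)).
  by move=> [x y] /=; rewrite addrK.
have gK : cancel (fun x : int * int => (x.1 - x.2, x.2)) (fun x => (x.1 + x.2, x.2)).
  by move=> [x y] /=; rewrite subrK.
rewrite (gsum_reindex _ _ hK gK) (@gsum_int2_split 2) //; last first.
  exact: summable_reindex hK gK (summable_prod s3 s5).
rewrite /index_iota subn0 [iota 0 2]/= !big_cons big_nil addr0.
have sq x : (-1) ^+ absz x * (-1) ^+ absz x = 1 :> int by rewrite -expr2 sqrr_sign.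
congr (_ + _).
  transitivity (tsum (fun x : int * int =>
      theta_exp 3 1 (2%:Z * x.1 + 0%:Z + x.2) + 5%:Z * theta_exp 3 1 x.2)).
    apply: eq_gsum => // x /=; rewrite (@sgr_absz _ x.2) ?sq //.
    by exists x.1; ring.
  apply: (@tsum_affine2 (-3) 1 1 0 (-2) 1 0 1 1 3 (-1) (-1)) => x y; try ring.
  rewrite /theta_exp /formZ /=; set j := (1 * x + 0 * y + 1).
  set k := (2%:Z * _ + 0%:Z + j); have := tri_double j; have := tri_double k.
  rewrite /k /j; lia.
transitivity ((-1)%:~R * tsum (fun x : int * int =>
    theta_exp 3 1 (2%:Z * x.1 + 1%:Z + x.2) + 5%:Z * theta_exp 3 1 x.2)).
  rewrite -gsum_scale; apply: eq_gsum => // x /=.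
  rewrite (@sgr_absz _ (x.2 + 1)); last by exists x.1; ring.
  have : (-1) ^+ absz (x.2 + 1) = - (-1) ^+ absz x.2 :> int.
    by rewrite -signr_odd -[in RHS]signr_odd; have -> : odd (absz (x.2 + 1)) = ~~ odd (absz x.2);
      [lia | rewrite signrN].
  by move=> ->; rewrite mulNr sq mulr1.
rewrite mulrNz mulr1z mulN1r; congr (- _).
apply: (@tsum_affine2 0 (-1) 1 0 (-1) 1 0 1 (-1) 0 (-1) (-1)) => x y; try ring.
rewrite /theta_exp /formW /=; set j := (1 * x + 0 * y + 1).
set k := (2%:Z * _ + 1%:Z + j); have := tri_double j; have := tri_double k.
rewrite /k /j; lia.
Qed.

Theorem phi_psi_euler :
  dilate 5 phi * dilate 2 psi - q * phi * dilate 10 psi = euler 1 * euler 5.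
Proof.
(* Class 1 cancels, and the equal classes 0 and 2 produce the factor 2 on the right, which can be
   cancelled over the integers. *)
have E : 2%:R * (dilate 5 phi * dilate 2 psi - q * phi * dilate 10 psi) =
         2%:R * (euler 1 * euler 5).
  by rewrite mulrBr phi5_psi2 phi_psi10 euler1_euler5 formZ02 formW02 formWZ1; ring.
apply: pseriesP => n; move/(congr1 (fun a : pseries => a n)): E.
by rewrite !mulr_natl !psmulnE; lia.
Qed.

(** * Eta quotients and dissections *)

Definition psi5 := dilate 5 psi.

Lemma psi_coef0 : psi 0%N = 1.
Proof.
by have := congr1 (fun a : pseries => a 0%N) psi_euler;
  rewrite psmul_coef0 psexp_coef0 !euler_coef0 // mulr1 expr1n.
Qed.

Lemma psi5_euler : psi5 * euler 5 = euler 10 ^+ 2.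
Proof.
by have := congr1 (dilate 5) psi_euler; rewrite dilateM dilateX !dilate_euler.
Qed.

Definition psiV := psi ^+ 2 - q * psi5 ^+ 2.

Lemma psiV_prod : psiV = psiA * psiB.
Proof. by rewrite /psiV {1}psi_sqr_sub addrK. Qed.

Lemma psiV_euler : psiV * (euler 1 * euler 10) = euler 2 * euler 5 ^+ 3.
Proof. by rewrite psiV_prod psiAB_euler. Qed.

(** With the next lemma, this expresses f_10^5 / f_2 and f_5^5 / f_1 through [psi], [psi5] and
    [psiV], so that relations among H, Y and Z become polynomial identities. *)
Lemma euler10_pow5 : psi5 ^+ 3 * psiV * euler 2 = euler 10 ^+ 5 * psi.
Proof.
apply: (@psmulI (euler 1 * euler 10 * euler 5 ^+ 3)).
  by rewrite !psmul_coef0 ?psexp_coef0 !euler_coef0.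
transitivity ((psi5 * euler 5) ^+ 3 * (psiV * (euler 1 * euler 10)) * euler 2); first by ring.
transitivity (euler 10 ^+ 6 * euler 5 ^+ 3 * (psi * euler 1)); last by ring.
by rewrite psi5_euler psiV_euler psi_euler; ring.
Qed.

Lemma euler5_pow5 : psi5 * psiV ^+ 2 * euler 1 = euler 5 ^+ 5 * psi.
Proof.
apply: (@psmulI (euler 1 * euler 10 ^+ 2 * euler 5)).
  by rewrite !psmul_coef0 ?psexp_coef0 !euler_coef0.
transitivity ((psi5 * euler 5) * (psiV * (euler 1 * euler 10)) ^+ 2); first by ring.
transitivity (euler 10 ^+ 2 * euler 5 ^+ 6 * (psi * euler 1)); last by ring.
by rewrite psi5_euler psiV_euler psi_euler; ring.
Qed.

Definition serH := q * euler 5 ^+ 5 * psinv (euler 1).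
Definition serY := q * psi ^+ 3 * psi5.
Definition serZ := q ^+ 2 * psi * psi5 ^+ 3.

Lemma dilate_serH : dilate 2 serH = q ^+ 2 * euler 10 ^+ 5 * psinv (euler 2).
Proof. by rewrite /serH 2!dilateM dilateX dilate_q // dilate_inv ?euler_coef0 // !dilate_euler. Qed.

Lemma psi_serH : psi * serH = q * psi5 * psiV ^+ 2.
Proof.
rewrite /serH; transitivity (q * (euler 5 ^+ 5 * psi) * psinv (euler 1)); first by ring.
rewrite -euler5_pow5.
transitivity (q * psi5 * psiV ^+ 2 * (euler 1 * psinv (euler 1))); first by ring.
by rewrite psmulV ?euler_coef0 // mulr1.
Qed.

Lemma psi_dilate_serH : psi * dilate 2 serH = q ^+ 2 * psi5 ^+ 3 * psiV.
Proof.
rewrite dilate_serH.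
transitivity (q ^+ 2 * (euler 10 ^+ 5 * psi) * psinv (euler 2)); first by ring.
rewrite -euler10_pow5.
transitivity (q ^+ 2 * psi5 ^+ 3 * psiV * (euler 2 * psinv (euler 2))); first by ring.
by rewrite psmulV ?euler_coef0 // mulr1.
Qed.

(** Multiplied by [psi], both sides are q p^2 r V with V = [psiV], because V + q r^2 = p^2. *)
Lemma serY_sub_serZ : serY - serZ = serH + dilate 2 serH.
Proof.
apply: (psmulI psi_coef0); rewrite [RHS]mulrDr psi_serH psi_dilate_serH.
by rewrite /serY /serZ /psiV; ring.
Qed.

Lemma qcubed_quotient (B : pseries) : B * psi = psi5 ^+ 5 ->
  q ^+ 3 * B = serZ - dilate 2 serH.
Proof.
move=> BE; apply: (psmulI psi_coef0); rewrite mulrBr psi_dilate_serH.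
transitivity (q ^+ 3 * (B * psi)); first by ring.
by rewrite BE /serZ /psiV; ring.
Qed.

(** * Sections modulo 5 *)

Lemma q_psi_cube_sections :
  q * psi ^+ 3 =
    q ^+ 1 * dilate 5 (psiA ^+ 3) + q ^+ 2 * dilate 5 (3%:R * psiA ^+ 2 * psiB)
  + q ^+ 3 * dilate 5 (3%:R * psiA * psiB ^+ 2)
  + q ^+ 4 * dilate 5 (psiB ^+ 3 + 3%:R * psiA ^+ 2 * psi5)
  + q ^+ 5 * dilate 5 (6%:R * psiA * psiB * psi5)
  + q ^+ 6 * dilate 5 (3%:R * psiB ^+ 2 * psi5)
  + q ^+ 7 * dilate 5 (3%:R * psiA * psi5 ^+ 2)
  + q ^+ 8 * dilate 5 (3%:R * psiB * psi5 ^+ 2)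
  + q ^+ 10 * dilate 5 (psi5 ^+ 3).
Proof.
have dil25 : dilate 25 psi = dilate 5 psi5 by rewrite dilate_comp.
by rewrite {1}psi_5dissection dil25 !(dilateX, dilateM, dilateD, dilate1); ring.
Qed.

Lemma section5_serY i : (i < 5)%N ->
  section 5 i serY = psi * section 5 i (q * psi ^+ 3).
Proof. by move=> i5; rewrite /serY mulrC section_dilateM. Qed.

Lemma section5_serZ i : (i < 5)%N ->
  section 5 i serZ = psi ^+ 3 * section 5 i
    (q ^+ 2 * dilate 5 psiA + q ^+ 3 * dilate 5 psiB + q ^+ 5 * dilate 5 psi5).
Proof.
move=> i5; rewrite /serZ mulrC -dilateX section_dilateM //.
congr (_ * section 5 i _); rewrite {1}psi_5dissection.
have -> : dilate 25 psi = dilate 5 psi5 by rewrite dilate_comp.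
by ring.
Qed.

Lemma section5_serZ0 : section 5 0 serZ = serY.
Proof.
rewrite section5_serZ // !sectionD !section_qX //= expr1 /serY; ring.
Qed.

(** The exponents 5 and 10 contribute p (6 q V r + q^2 r^3); substituting V = p^2 - q r^2 gives the
    combination of Y and Z. *)
Lemma section5_serY0 : section 5 0 serY = 6%:R * serY - 5%:R * serZ.
Proof.
rewrite section5_serY // q_psi_cube_sections !sectionD !section_qX //=.
rewrite /serY /serZ; transitivity (6%:R * q * psi * psi5 * psiV + q ^+ 2 * psi * psi5 ^+ 3).
  by rewrite psiV_prod; ring.
by rewrite /psiV; ring.
Qed.

(** With A = [psiA] and B = [psiB], the exponents 2 and 7 contribute 3 A (A B + q r^2), which is 3 A
    p^2 by (R1). *)
Lemma section5_serY2 : section 5 2 serY = 3%:R * section 5 2 serZ.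
Proof.
rewrite section5_serY // section5_serZ // q_psi_cube_sections !sectionD !section_qX //=.
transitivity (3%:R * psi * psiA * (psiV + q * psi5 ^+ 2)); first by rewrite psiV_prod; ring.
by rewrite /psiV; ring.
Qed.

Lemma section5_serY3 : section 5 3 serY = 3%:R * section 5 3 serZ.
Proof.
rewrite section5_serY // section5_serZ // q_psi_cube_sections !sectionD !section_qX //=.
transitivity (3%:R * psi * psiB * (psiV + q * psi5 ^+ 2)); first by rewrite psiV_prod; ring.
by rewrite /psiV; ring.
Qed.

(** * Sections modulo 2 *)

Lemma phi_2dissection : phi = dilate 4 phi + 2%:R * q * dilate 8 psi.
Proof.
have -> : 2%:R * q * dilate 8 psi = q * dilate 4 (tsum (quad 1 1 0)).
  by rewrite tsum_pronic dilateM dilate_comp // rmorph_nat; ring.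
rewrite phiE !dilate_tsum_quad // tsum_quadS // (@tsum_quad_split 2) //.
rewrite /index_iota subn0 [iota 0 2]/= !big_cons big_nil.
by congr (_ + _); rewrite [LHS]addr0; apply: eq_gsum => // x; rewrite /quad; ring.
Qed.

Lemma qnegD : {morph qneg : a b / a + b}. Proof. exact: rmorphD. Qed.
Lemma qnegM : {morph qneg : a b / a * b}. Proof. exact: rmorphM. Qed.

Lemma phi_neg_2dissection : phi_neg = dilate 4 phi - 2%:R * q * dilate 8 psi.
Proof.
rewrite -qneg_phi [in LHS]phi_2dissection qnegD !qnegM qneg_q !qneg_dilate_even //.
by rewrite [qneg 2%:R]rmorph_nat; ring.
Qed.

Lemma serY_sub_serZ_euler : serY - serZ =
  q * euler 2 ^+ 3 * euler 5 ^+ 2 * euler 10 * psinv (euler 1) ^+ 2.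
Proof.
transitivity (q * (psi * psi5 * psiV)); first by rewrite /serY /serZ /psiV; ring.
rewrite -!mulrA; congr (_ * _).
apply: (@psmulI (euler 1 ^+ 2 * euler 10 * euler 5)).
  by rewrite !psmul_coef0 ?psexp_coef0 !euler_coef0.
transitivity ((psi * euler 1) * (psi5 * euler 5) * (psiV * (euler 1 * euler 10))).
  by ring.
rewrite psi_euler psi5_euler psiV_euler.
transitivity (euler 2 ^+ 3 * euler 5 ^+ 3 * euler 10 ^+ 2 * (euler 1 * psinv (euler 1)) ^+ 2).
  by rewrite psmulV ?euler_coef0 //; ring.
by ring.
Qed.

(** Isolating a factor in q^2 lets the even section act on q phi(q) phi(-q^5) alone. *)
Lemma serY_sub_serZ_phi : serY - serZ =
  dilate 2 ((euler 5 * euler 2 * psinv (euler 1)) ^+ 2) * (q * (phi * dilate 5 phi_neg)).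
Proof.
have e1 : dilate 2 (euler 1) = euler 2 by rewrite dilate_euler.
have e2 : dilate 2 (euler 2) = euler 4 by rewrite dilate_euler.
have e5 : dilate 2 (euler 5) = euler 10 by rewrite dilate_euler.
rewrite dilateX !dilateM dilate_inv ?euler_coef0 // e1 e2 e5.
rewrite serY_sub_serZ_euler [RHS]mulrCA -!mulrA; congr (_ * _).
have p5 : dilate 5 phi_neg * euler 10 = euler 5 ^+ 2.
  by have := congr1 (dilate 5) phi_neg_euler; rewrite dilateM dilateX !dilate_euler.
apply: (@psmulI (euler 1 ^+ 2 * euler 4 ^+ 2)).
  by rewrite !psmul_coef0 ?psexp_coef0 !euler_coef0.
transitivity (euler 2 ^+ 3 * euler 5 ^+ 2 * euler 10 * euler 4 ^+ 2 *
  (euler 1 * psinv (euler 1)) ^+ 2); first by ring.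
transitivity ((phi * (euler 1 ^+ 2 * euler 4 ^+ 2)) * (dilate 5 phi_neg * euler 10) *
  euler 10 * euler 4 ^+ 2 * psinv (euler 2) ^+ 2); last by ring.
rewrite phi_euler p5 psmulV ?euler_coef0 //.
transitivity (euler 2 ^+ 3 * euler 5 ^+ 2 * euler 10 * euler 4 ^+ 2 *
  (euler 2 * psinv (euler 2)) ^+ 2); last by ring.
by rewrite psmulV ?euler_coef0 //; ring.
Qed.

(** In the product of the two 2-dissections, the cross terms are those of even exponent; they
    assemble into (R2) at q^2. *)
Lemma section2_phi : section 2 0 (q * (phi * dilate 5 phi_neg)) =
  2%:R * q * (euler 2 * euler 10).
Proof.
have E : q * (phi * dilate 5 phi_neg) =
    q ^+ 1 * dilate 2 (dilate 2 phi * dilate 10 phi)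
  + q ^+ 2 * dilate 2 (dilate 4 psi * dilate 10 phi *+ 2)
  + q ^+ 6 * dilate 2 (- (dilate 2 phi * dilate 20 psi *+ 2))
  + q ^+ 7 * dilate 2 (- (dilate 4 psi * dilate 20 psi *+ 4)).
  rewrite !rmorphN !rmorphMn /= !dilateM !dilate_comp //.
  rewrite {1}phi_2dissection phi_neg_2dissection dilateB !dilateM.
  rewrite dilate_q // !dilate_comp // [dilate 5 2%:R]rmorph_nat; ring.
rewrite E !sectionD !section_qX //=.
have := congr1 (dilate 2) phi_psi_euler.
rewrite dilateB !dilateM dilate_q // !dilate_comp // !dilate_euler // => <-.
ring.
Qed.

Lemma section2_serY_sub_serZ :
  section 2 0 (serY - serZ) = 2%:R * (serY - serZ).
Proof.
rewrite {1}serY_sub_serZ_phi section_dilateM // section2_phi.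
by rewrite serY_sub_serZ_euler; ring.
Qed.

(** * The coefficients of psi(-q^5)^5 / psi(-q) *)

Lemma triangular_double m : (2 * 'C(m.+1, 2) = m * m.+1)%N.
Proof. by elim: m => // m IHm; rewrite binS bin1; lia. Qed.

(** Even [m] corresponds to the index -m/2 and odd [m] to (m + 1)/2, so the one-sided sum runs over
    all integers. *)
Lemma psi_tsum_nat : psi = tsum (fun m : nat => 'C(m.+1, 2)%:Z).
Proof.
rewrite psiE (@gsum_reindex _ _ (fun m : nat => if odd m then (m.+1)./2%:Z else - (m./2)%:Z)
  (fun j : int => if 0 < j then (absz j).*2.-1 else (absz j).*2)).
- apply: eq_gsum => // m; rewrite /quad /=; have := triangular_double m.
  by case: ifP => om; have := odd_double_half m; have := odd_double_half m.+1; rewrite /= om /=; nia.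
- move=> m; have := odd_double_half m; have := odd_double_half m.+1 => /=.
  by case: (odd m) => /= h1 h2; case: ifP; lia.
- move=> j /=; have [j0|j0] := boolP (0 < j); last by rewrite odd_double doubleK; lia.
  have [k ->] : exists k : nat, j = k.+1%:Z by exists (absz j).-1; lia.
  by rewrite /= odd_double /= doubleK.
Qed.

Lemma psi_neg_qneg : PSeries psi_neg = qneg psi.
Proof.
apply: pseriesP => n; rewrite psi_tsum_nat /= /psi_neg.
transitivity ((-1) ^+ n * \sum_(0 <= m < n.+1 | 'C(m.+1, 2) == n) (1 : int)).
  by rewrite big_mkord mulr_sumr; apply: eq_bigr => m _; rewrite mulr1.
congr (_ * _); rewrite -[LHS]big_filter [LHS]fsbig_seq ?filter_uniq ?iota_uniq //.
set r := [seq i <- _ | _].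
apply: eq_fsbigl; apply/seteqP; split=> m /=; rewrite mem_filter mem_index_iota.
  by move=> /andP[/eqP -> _].
by have := triangular_double m; nia.
Qed.

Lemma fps_exp_ps a m : PSeries (fps_exp a m) = PSeries a ^+ m.
Proof. by elim: m => // m IHm; rewrite exprS -IHm. Qed.

Lemma b5bar_quotient : qneg (PSeries b5bar) * psi = psi5 ^+ 5.
Proof.
have E : PSeries b5bar = dilate 5 (PSeries psi_neg) ^+ 5 * psinv (PSeries psi_neg).
  by rewrite -[dilate 5 _]/(PSeries (fps_dilate 5 psi_neg)) -fps_exp_ps.
rewrite E psi_neg_qneg -qneg_dilate_odd // -/psi5.
have -> : qneg psi5 ^+ 5 = qneg (psi5 ^+ 5) by rewrite [RHS]rmorphXn.
have psi0 : qneg psi 0%N = 1 by rewrite -[LHS]/(1 * psi 0%N) psi_coef0.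
transitivity (qneg (qneg (psi5 ^+ 5) * (qneg psi * psinv (qneg psi)))).
  by rewrite !qnegM !qnegK; ring.
by rewrite psmulV // mulr1 qnegK.
Qed.

Definition b5series := qneg (PSeries b5bar).

(** The series X of the overview: after the shift by 3, passing from n to 5^k (n + 3) - 3 multiplies
    the index by 5^k. *)
Definition b5shift := q ^+ 3 * b5series.

Lemma b5shiftE : b5shift = serZ - dilate 2 serH.
Proof. exact/qcubed_quotient/b5bar_quotient. Qed.

Lemma b5shift_coef n : b5shift (n + 3)%N = (-1) ^+ n * b5bar n.
Proof. by rewrite /b5shift qXmulE leq_addl addnK. Qed.

(** * The recurrence along powers of 5 and the congruences *)

Definition half_coef (a : pseries) N := if odd N then 0 else a N./2.

Lemma dilate2E (a : pseries) N : dilate 2 a N = half_coef a N.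
Proof. by rewrite dilateE dvdn2 /half_coef divn2; case: odd. Qed.

Lemma serYZH N : serY N - serZ N = serH N + half_coef serH N.
Proof.
by move/(congr1 (fun a : pseries => a N)): serY_sub_serZ; rewrite !psaddE psoppE dilate2E.
Qed.

Lemma b5shift_serZH N : b5shift N = serZ N - half_coef serH N.
Proof. by rewrite b5shiftE psaddE psoppE dilate2E. Qed.

Lemma serZ5 N : serZ (5 * N)%N = serY N.
Proof. by rewrite -section5_serZ0 sectionE addn0. Qed.

Lemma serY5 N : serY (5 * N)%N = 6 * serY N - 5 * serZ N.
Proof.
move/(congr1 (fun a : pseries => a N)): section5_serY0.
by rewrite sectionE addn0 psaddE psoppE !psmul_natE.
Qed.

Lemma serY_serZ N : (N %% 5 = 2 \/ N %% 5 = 3)%N -> serY N = 3 * serZ N.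
Proof.
move=> [] N5; rewrite (divn_eq N 5) N5 mulnC.
  move/(congr1 (fun a : pseries => a (N %/ 5)%N)): section5_serY2.
  by rewrite sectionE psmul_natE.
move/(congr1 (fun a : pseries => a (N %/ 5)%N)): section5_serY3.
by rewrite sectionE psmul_natE.
Qed.

Lemma half_coef5 (a : pseries) N :
  half_coef a (5 * N) = if odd N then 0 else a (5 * N./2)%N.
Proof. by rewrite /half_coef oddM /=; case: ifP => // oN; congr (a _); lia. Qed.

(* serH + serH(q^2) = serY - serZ is an eigenvector of a_N |-> a_(5N); the two
   summands can be separated since the index halves in the second one. *)
Lemma serH5 N : serH (5 * N)%N = 5 * serH N.
Proof.
elim/ltn_ind: N => N IH.
have := serYZH (5 * N); have := serYZH N; rewrite serZ5 serY5 half_coef5.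
rewrite {1}/half_coef; case: ifP => oN; first by lia.
(* Halving 0 gives no smaller index, but there the factor q makes the coefficient vanish. *)
have [->|N0] := posnP N.
  by rewrite muln0 /serH -mulrA qmulE mulr0.
by rewrite (IH N./2); lia.
Qed.

(** Both parts of X satisfy U^2 = 6 U - 5: for Z because U Z = Y, for H(q^2) because 5 is a root of
    T^2 - 6 T + 5. *)
Lemma b5shift_recurrence N : b5shift (25 * N)%N = 6 * b5shift (5 * N)%N - 5 * b5shift N.
Proof.
have -> : (25 * N = 5 * (5 * N))%N by lia.
rewrite !b5shift_serZH !half_coef5 !serZ5 serY5.
have -> : odd (5 * N) = odd N by rewrite oddM.
rewrite /half_coef; case: ifP => oN; first by lia.
have -> : ((5 * N)./2 = 5 * N./2)%N by lia.
by rewrite !serH5; lia.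
Qed.

(** The roots of T^2 - 6 T + 5 are 1 and 5, and the factor 4 is their difference. *)
Lemma b5shift_pow5 k N :
  4 * b5shift (5 ^ k * N)%N = 5 * b5shift N - b5shift (5 * N)%N + (5 ^ k)%N%:Z * (b5shift (5 * N)%N - b5shift N).
Proof.
elim/ltn_ind: k => -[|[|k]] IH.
- by rewrite mul1n; lia.
- by rewrite expn1; lia.
- have -> : (5 ^ k.+2 * N = 25 * (5 ^ k * N))%N by rewrite !expnS; lia.
  rewrite b5shift_recurrence mulrBr !(mulrCA 4).
  have -> : (5 * (5 ^ k * N) = 5 ^ k.+1 * N)%N by rewrite expnS; lia.
  rewrite !IH //; rewrite !expnS; nia.
Qed.

Lemma b5shift_vanish M : odd M -> (2 * M %% 5 = 2 \/ 2 * M %% 5 = 3)%N ->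
  b5shift (2 * M)%N = 0.
Proof.
move=> oM M5; rewrite b5shift_serZH.
have := serY_serZ M5; have := serYZH M; rewrite /half_coef oM mul2n odd_double doubleK.
move/(congr1 (fun a : pseries => a M)): section2_serY_sub_serZ.
by rewrite sectionE addn0 mul2n psmul_natE !psaddE !psoppE; lia.
Qed.

Lemma b5bar_b5shift N : (3 <= N)%N -> b5bar (N - 3)%N = (-1) ^+ (N - 3) * b5shift N.
Proof.
move=> N3; rewrite -{3}(subnK N3) b5shift_coef mulrA -expr2 sqrr_sign mul1r //.
Qed.

Lemma b5bar_pow5 k N : (3 <= N)%N ->
  4 * b5bar (5 ^ k * N - 3)%N =
  (-1) ^+ (N - 3) * (5 * b5shift N - b5shift (5 * N)%N + (5 ^ k)%N%:Z * (b5shift (5 * N)%N - b5shift N)).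
Proof.
move=> N3; have kN : (N <= 5 ^ k * N)%N by rewrite leq_pmull ?expn_gt0.
rewrite b5bar_b5shift ?(leq_trans N3) // mulrCA b5shift_pow5; congr (_ * _).
rewrite -signr_odd -[RHS]signr_odd !oddB ?(leq_trans N3) // oddM oddX orbT //.
Qed.

Lemma b5bar_pow5_vanish k M : (3 <= M)%N -> odd M ->
  (2 * M %% 5 = 2 \/ 2 * M %% 5 = 3)%N ->
  (b5bar (5 ^ k * (2 * M) - 3)%N = 0 %[mod ((5 ^ k - 1) %/ 4)%N%:Z])%Z.
Proof.
move=> M3 oM M5; have M3' : (3 <= 2 * M)%N by lia.
have := b5bar_pow5 k M3'; rewrite b5shift_vanish //.
have := divnK (dvdn4_exp5_sub1 k); have : (0 < 5 ^ k)%N by rewrite expn_gt0.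
set d := ((5 ^ k - 1) %/ 4)%N; set s := (-1) ^+ _; set y := b5shift _ => k0 dk b4.
(* With X vanishing at 2 M, [b5bar_pow5] reads 4 b = s (5^k - 1) y, and 5^k - 1 = 4 d. *)
apply/eqP; rewrite eqz_mod_dvd subr0; apply/dvdzP; exists (s * y).
have {}dk : (5 ^ k)%N%:Z = 4 * d%:Z + 1 by lia.
by move: b4; rewrite dk; lia.
Qed.

Theorem corollary8 (n k : nat) (hk : (2 <= k)%N) :
  (4 * b5bar (5 ^ k * (n + 3) - 3)%N
     = 5 * b5bar n - b5bar (5 * n + 12)%N %[mod (5 ^ k)%N%:Z])%Z
  /\ (b5bar (5 ^ k * (20 * n + 18) - 3)%N
     = 0 %[mod ((5 ^ k - 1) %/ 4)%N%:Z])%Z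
  /\ (b5bar (5 ^ k * (20 * n + 22) - 3)%N
     = 0 %[mod ((5 ^ k - 1) %/ 4)%N%:Z])%Z.
Proof.
split; last first.
  (* Both cofactors of 2 are odd, and 18 and 22 are 3 and 2 modulo 5. *)
  have -> : (20 * n + 18 = 2 * (10 * n + 9))%N by lia.
  have -> : (20 * n + 22 = 2 * (10 * n + 11))%N by lia.
  by split; apply: b5bar_pow5_vanish; lia.
rewrite b5bar_pow5 ?leq_addl // addnK.
have bn : b5bar n = (-1) ^+ n * b5shift (n + 3)%N.
  by rewrite -[in LHS](addnK 3 n) b5bar_b5shift ?leq_addl // addnK.
have b5n : b5bar (5 * n + 12)%N = (-1) ^+ n * b5shift (5 * (n + 3))%N.
  have -> : (5 * n + 12 = 5 * (n + 3) - 3)%N by lia.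
  rewrite b5bar_b5shift; last by lia.
  by rewrite -signr_odd -[in RHS]signr_odd; congr (_ ^+ nat_of_bool _ * _); lia.
apply/eqP; rewrite eqz_mod_dvd bn b5n; apply/dvdzP.
(* The quotient is the cofactor of 5^k in [b5bar_pow5]. *)
exists ((-1) ^+ n * (b5shift (5 * (n + 3))%N - b5shift (n + 3)%N)); ring.
Qed.
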